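(* Let $f$ be a bounded octonion-valued slice regular function on $\mathbb B=\{w\in\mathbb O:|w|<1\}$ and let $d=\sup_{z,w\in f(\mathbb B)}|z-w|$ be the Euclidean diameter of the image set $f(\mathbb B)$. Then $$\frac{|f^{(n)}(0)|}{n!}\leq\frac12 d$$ holds for every positive integer $n$. Moreover, equality holds for some positive integer $n_0$ if and only if $$f(w)=f(0)+\frac12 w^{n_0}d\,e^{I\theta}$$ for some $I\in\mathbb S$ and some $\theta\in\mathbb R$.
   Context: $\mathbb O$ is the real division algebra of octonions, with norm $|w|$. $\mathbb S=\{w\in\mathbb O:w^2=-1\}$; for $I\in\mathbb S$, $\mathbb C_I=\mathbb R\oplus I\mathbb R$, $\Omega_I=\Omega\cap\mathbb C_I$, and $e^{I\theta}=\cos\theta+I\sin\theta$. $f:\Omega\to\mathbb O$ on a domain $\Omega\subseteq\mathbb O$ is slice regular if for every $I\in\mathbb S$ its restriction $f_I$ to $\Omega_I$ has continuous partial derivatives and $\frac12(\frac{\partial}{\partial x}+I\frac{\partial}{\partial y})f_I(x+yI)=0$ on $\Omega_I$. The slice derivative is $f'(x+yI)=\frac12(\frac{\partial}{\partial x}-I\frac{\partial}{\partial y})f_I(x+yI)$, which is again slice regular, and $f^{(n)}$ is the $n$-th iterated slice derivative. Slice regular functions on $\mathbb B$ are exactly the convergent power series $f(w)=\sum_{n\ge0} w^na_n$ with $a_n=f^{(n)}(0)/n!\in\mathbb O$. *)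

(* Defs.v *)
From Stdlib Require Import Reals Lra.
From Coquelicot Require Import Coquelicot.

Open Scope R_scope.

(** ** Octonions *)

Definition Quat : Type := (C * C)%type.

Definition Qconj (p : Quat) : Quat := (Cconj (fst p), Copp (snd p)).

Definition Qplus (p q : Quat) : Quat :=
  (Cplus (fst p) (fst q), Cplus (snd p) (snd q)).

Definition Qopp (p : Quat) : Quat := (Copp (fst p), Copp (snd p)).

(** Cayley-Dickson doubling of [C]: (a, b)(c, d) = (a c - d* b, d a + b c* ). *)
Definition Qmult (p q : Quat) : Quat :=
  let (a, b) := p in let (c, d) := q in
  (Cminus (Cmult a c) (Cmult (Cconj d) b),
   Cplus (Cmult d a) (Cmult b (Cconj c))).

(** The underlying real normed space of the octonions is R^8, as nested pairs.
    Coquelicot's norm on a product is sqrt (|x|^2 + |y|^2), so [norm] below is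
    the Euclidean norm (lemma [norm_Oct]). *)
Definition C_NM : NormedModule R_AbsRing :=
  prod_NormedModule R_AbsRing R_NormedModule R_NormedModule.

Definition Quat_NM : NormedModule R_AbsRing :=
  prod_NormedModule R_AbsRing C_NM C_NM.

Definition Oct_NM : NormedModule R_AbsRing :=
  prod_NormedModule R_AbsRing Quat_NM Quat_NM.

Notation Oct := (NormedModule.sort R_AbsRing Oct_NM).

(** Cayley-Dickson doubling of [Quat]. *)
Definition Omult (p q : Oct) : Oct :=
  let (a, b) := (p : Quat * Quat) in
  let (c, d) := (q : Quat * Quat) in
  (Qplus (Qmult a c) (Qopp (Qmult (Qconj d) b)),
   Qplus (Qmult d a) (Qmult b (Qconj c))).

Definition Oreal (x : R) : Oct :=
  ((((x, 0), (0, 0)), ((0, 0), (0, 0))) : Quat * Quat).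

Definition Ozero : Oct := Oreal 0.

Definition Oone : Oct := Oreal 1.

Definition Oi : Oct := ((((0, 1), (0, 0)), ((0, 0), (0, 0))) : Quat * Quat).

Fixpoint Opow (w : Oct) (n : nat) : Oct :=
  match n with
  | 0%nat => Oone
  | S m => Omult w (Opow w m)
  end.

Definition Ore (w : Oct) : R := fst (fst (fst (w : Quat * Quat))).

Definition Oim (w : Oct) : Oct := minus w (Oreal (Ore w)).

Definition imag_unit (I : Oct) : Prop := Omult I I = opp Oone.

(** The point x + y I of the slice C_I. *)
Definition slice_pt (I : Oct) (x y : R) : Oct := plus (Oreal x) (scal y I).

Definition Oexp (I : Oct) (theta : R) : Oct :=
  slice_pt I (cos theta) (sin theta).

Definition unit_ball (w : Oct) : Prop := norm w < 1.

(** ** Slice regular functions *)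

(** Derivative of a curve in R^8, coordinate by coordinate; it is the derivative
    in the normed space [Oct_NM] wherever that exists (lemma [Oderive_correct]). *)
Definition Cderive (g : R -> C) (t : R) : C :=
  (Derive (fun s => fst (g s)) t, Derive (fun s => snd (g s)) t).

Definition Qderive (g : R -> Quat) (t : R) : Quat :=
  (Cderive (fun s => fst (g s)) t, Cderive (fun s => snd (g s)) t).

Definition Oderive (g : R -> Oct) (t : R) : Oct :=
  (Qderive (fun s => fst (g s : Quat * Quat)) t,
   Qderive (fun s => snd (g s : Quat * Quat)) t).

Definition slice_dx (f : Oct -> Oct) (I : Oct) (x y : R) : Oct :=
  Oderive (fun t => f (slice_pt I t y)) x.

Definition slice_dy (f : Oct -> Oct) (I : Oct) (x y : R) : Oct :=
  Oderive (fun t => f (slice_pt I x t)) y.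

(** [Omega] is meant to be open, so that the partial derivatives at a point of
    [Omega] only depend on the restriction of [f] to [Omega]. *)
Definition slice_regular (Omega : Oct -> Prop) (f : Oct -> Oct) : Prop :=
  forall I : Oct, imag_unit I ->
  forall x y : R, Omega (slice_pt I x y) ->
    ex_derive (K := R_AbsRing) (V := Oct_NM) (fun t => f (slice_pt I t y)) x /\
    ex_derive (K := R_AbsRing) (V := Oct_NM) (fun t => f (slice_pt I x t)) y /\
    continuous (U := Oct_NM)
      (fun p : R * R => slice_dx f I (fst p) (snd p)) (x, y) /\
    continuous (U := Oct_NM)
      (fun p : R * R => slice_dy f I (fst p) (snd p)) (x, y) /\
    scal (1 / 2) (plus (slice_dx f I x y) (Omult I (slice_dy f I x y))) = Ozero.

(** An imaginary unit I and a real y with w = Re w + y I. At real points every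
    imaginary unit qualifies and [Oi] is used; for slice regular functions the
    slice derivative does not depend on these choices (lemma [slice_derivE]). *)
Definition slice_unit (w : Oct) : Oct :=
  if Req_EM_T (norm (Oim w)) 0 then Oi else scal (/ norm (Oim w)) (Oim w).

Definition slice_deriv (f : Oct -> Oct) (w : Oct) : Oct :=
  let I := slice_unit w in
  let x := Ore w in
  let y := norm (Oim w) in
  scal (1 / 2) (minus (slice_dx f I x y) (Omult I (slice_dy f I x y))).

Fixpoint slice_deriv_n (n : nat) (f : Oct -> Oct) : Oct -> Oct :=
  match n with
  | 0%nat => f
  | S m => slice_deriv (slice_deriv_n m f)
  end.

(** ** Images and diameters *)

Definition image (f : Oct -> Oct) (A : Oct -> Prop) : Oct -> Prop :=
  fun u => exists w : Oct, A w /\ u = f w.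

Definition bounded_on (A : Oct -> Prop) (f : Oct -> Oct) : Prop :=
  exists M : R, forall w : Oct, A w -> norm (f w) <= M.

(** As a real number, this is the supremum only when that supremum is finite
    (lemma [diameter_is_lub]). *)
Definition diameter (A : Oct -> Prop) : R :=
  real (Lub_Rbar (fun r => exists z w : Oct, A z /\ A w /\ r = norm (minus z w))).

(** ** Sanity lemmas *)

Lemma norm_Oct (a b c d e f g h : R) :
  norm ((((a, b), (c, d)), ((e, f), (g, h))) : Oct) =
  sqrt (a ^ 2 + b ^ 2 + c ^ 2 + d ^ 2 + e ^ 2 + f ^ 2 + g ^ 2 + h ^ 2).
Proof.
assert (abs2 : forall x : R, Rabs x ^ 2 = x ^ 2).
{ intros x. rewrite <- Rsqr_pow2, <- Rsqr_abs, Rsqr_pow2. reflexivity. }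
change (sqrt (sqrt (sqrt (Rabs a ^ 2 + Rabs b ^ 2) ^ 2 +
  sqrt (Rabs c ^ 2 + Rabs d ^ 2) ^ 2) ^ 2 +
  sqrt (sqrt (Rabs e ^ 2 + Rabs f ^ 2) ^ 2 +
  sqrt (Rabs g ^ 2 + Rabs h ^ 2) ^ 2) ^ 2) = 
  sqrt (a ^ 2 + b ^ 2 + c ^ 2 + d ^ 2 + e ^ 2 + f ^ 2 + g ^ 2 + h ^ 2)).
rewrite !abs2.
pose proof (pow2_ge_0 a); pose proof (pow2_ge_0 b); pose proof (pow2_ge_0 c);
pose proof (pow2_ge_0 d); pose proof (pow2_ge_0 e); pose proof (pow2_ge_0 f);
pose proof (pow2_ge_0 g); pose proof (pow2_ge_0 h).
rewrite !pow2_sqrt by (try apply Rplus_le_le_0_compat; try apply pow2_ge_0; lra).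
f_equal; ring.
Qed.

Lemma norm_Omult (p q : Oct) : norm (Omult p q) = norm p * norm q.
Proof.
destruct p as [[[a b] [c d]] [[e f] [g h]]].
destruct q as [[[a' b'] [c' d']] [[e' f'] [g' h']]].
unfold Omult, Qplus, Qopp, Qmult, Qconj, Cminus, Cplus, Copp, Cmult, Cconj;
  cbn [fst snd].
rewrite !norm_Oct, <- sqrt_mult_alt.
- f_equal; ring.
- repeat apply Rplus_le_le_0_compat; apply pow2_ge_0.
Qed.

Lemma norm_Oscal (r : R) (p : Oct) : norm (scal r p : Oct) = Rabs r * norm p.
Proof.
destruct p as [[[a b] [c d]] [[e f] [g h]]].
change (scal r ((((a, b), (c, d)), ((e, f), (g, h))) : Oct)) with
  ((((r * a, r * b), (r * c, r * d)), ((r * e, r * f), (r * g, r * h))) : Oct).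
rewrite !norm_Oct, <- (sqrt_Rsqr_abs r), <- sqrt_mult_alt.
- f_equal; unfold Rsqr; ring.
- apply Rle_0_sqr.
Qed.

Lemma Oderive_correct (g : R -> Oct) (t : R) :
  ex_derive (K := R_AbsRing) (V := Oct_NM) g t ->
  is_derive (K := R_AbsRing) (V := Oct_NM) g t (Oderive g t).
Proof.
assert (dfst : forall (U V : NormedModule R_AbsRing)
    (u : R -> prod_NormedModule R_AbsRing U V) (l : prod_NormedModule R_AbsRing U V),
    is_derive u t l -> is_derive (K := R_AbsRing) (fun s => fst (u s)) t (fst l)).
{ intros U V u l Hu.
  apply (filterdiff_ext_lin _ (fun y : R => fst (scal y l))); [|reflexivity].
  apply (filterdiff_comp' u fst t _ _ Hu).
  apply filterdiff_linear, is_linear_fst. }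
assert (dsnd : forall (U V : NormedModule R_AbsRing)
    (u : R -> prod_NormedModule R_AbsRing U V) (l : prod_NormedModule R_AbsRing U V),
    is_derive u t l -> is_derive (K := R_AbsRing) (fun s => snd (u s)) t (snd l)).
{ intros U V u l Hu.
  apply (filterdiff_ext_lin _ (fun y : R => snd (scal y l))); [|reflexivity].
  apply (filterdiff_comp' u snd t _ _ Hu).
  apply filterdiff_linear, is_linear_snd. }
intros [l Hl].
replace (Oderive g t) with l; [exact Hl|].
pose proof (dfst _ _ _ _ Hl) as H0; pose proof (dsnd _ _ _ _ Hl) as H1.
pose proof (dfst _ _ _ _ H0) as H00; pose proof (dsnd _ _ _ _ H0) as H01.
pose proof (dfst _ _ _ _ H1) as H10; pose proof (dsnd _ _ _ _ H1) as H11.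
pose proof (is_derive_unique _ _ _ (dfst _ _ _ _ H00)) as E1.
pose proof (is_derive_unique _ _ _ (dsnd _ _ _ _ H00)) as E2.
pose proof (is_derive_unique _ _ _ (dfst _ _ _ _ H01)) as E3.
pose proof (is_derive_unique _ _ _ (dsnd _ _ _ _ H01)) as E4.
pose proof (is_derive_unique _ _ _ (dfst _ _ _ _ H10)) as E5.
pose proof (is_derive_unique _ _ _ (dsnd _ _ _ _ H10)) as E6.
pose proof (is_derive_unique _ _ _ (dfst _ _ _ _ H11)) as E7.
pose proof (is_derive_unique _ _ _ (dsnd _ _ _ _ H11)) as E8.
destruct l as [[[a b] [c d]] [[e h] [k m]]].
symmetry.
unfold Oderive, Qderive, Cderive.
repeat apply f_equal2; assumption.
Qed.

Lemma imag_unit_re_norm (I : Oct) : imag_unit I -> Ore I = 0 /\ norm I = 1.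
Proof.
destruct I as [[[a b] [c d]] [[e f] [g h]]].
intros HI.
pose proof (f_equal (fun q => fst (fst (fst (q : Quat * Quat)))) HI) as E0.
pose proof (f_equal (fun q => snd (fst (fst (q : Quat * Quat)))) HI) as E1.
pose proof (f_equal (fun q => fst (snd (fst (q : Quat * Quat)))) HI) as E2.
pose proof (f_equal (fun q => snd (snd (fst (q : Quat * Quat)))) HI) as E3.
pose proof (f_equal (fun q => fst (fst (snd (q : Quat * Quat)))) HI) as E4.
pose proof (f_equal (fun q => snd (fst (snd (q : Quat * Quat)))) HI) as E5.
pose proof (f_equal (fun q => fst (snd (snd (q : Quat * Quat)))) HI) as E6.
pose proof (f_equal (fun q => snd (snd (snd (q : Quat * Quat)))) HI) as E7.
cbv [Omult Qplus Qopp Qmult Qconj Cminus Cplus Copp Cmult Cconj fst snd] in *.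
change (opp Oone) with
  ((((- (1), - 0), (- 0, - 0)), ((- 0, - 0), (- 0, - 0))) : Quat * Quat) in *.
cbv beta iota in *.
assert (Ha : a = 0).
{ destruct (Req_dec a 0) as [|Na]; [assumption|exfalso].
  assert (Z : forall x : R, 2 * a * x = 0 -> x = 0).
  { intros x Hx. apply Rmult_integral in Hx. destruct Hx; [lra|assumption]. }
  assert (b = 0) by (apply Z; lra). assert (c = 0) by (apply Z; lra).
  assert (d = 0) by (apply Z; lra). assert (e = 0) by (apply Z; lra).
  assert (f = 0) by (apply Z; lra). assert (g = 0) by (apply Z; lra).
  assert (h = 0) by (apply Z; lra). subst. nra. }
split; [exact Ha|].
rewrite norm_Oct. rewrite <- sqrt_1. f_equal. subst a. lra.
Qed.

Lemma imag_unit_scal (I : Oct) (r : R) :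
  imag_unit I -> r * r = 1 -> imag_unit (scal r I).
Proof.
unfold imag_unit. intros HI Hr.
assert (E : Omult (scal r I) (scal r I) = scal (r * r) (Omult I I)).
{ destruct I as [[[a b] [c d]] [[e f] [g h]]].
  change (scal r ((((a, b), (c, d)), ((e, f), (g, h))) : Oct)) with
    ((((r * a, r * b), (r * c, r * d)), ((r * e, r * f), (r * g, r * h))) : Oct).
  cbv [Omult Qplus Qopp Qmult Qconj Cminus Cplus Copp Cmult Cconj fst snd].
  match goal with |- _ = scal ?k (((?p, ?q), (?u, ?v)), ((?s, ?t), (?y, ?z))) =>
    change (scal k ((((p, q), (u, v)), ((s, t), (y, z))) : Oct)) with
    ((((k * p, k * q), (k * u, k * v)), ((k * s, k * t), (k * y, k * z))) : Oct)
  end.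
  repeat apply f_equal2; ring. }
rewrite E, Hr, HI. apply (scal_one (K := R_AbsRing)).
Qed.

Lemma slice_unit_correct (I : Oct) (x y : R) :
  imag_unit I ->
  let w := slice_pt I x y in
  Ore w = x /\ imag_unit (slice_unit w) /\
  scal (norm (Oim w)) (slice_unit w) = scal y I.
Proof.
intros HI w.
destruct (imag_unit_re_norm I HI) as [Hre Hn].
assert (Hx : Ore w = x).
{ unfold w. destruct I as [[[a b] [c d]] [[e f] [g h]]].
  change (a = 0) in Hre. change (x + y * a = x). rewrite Hre. ring. }
assert (Him : Oim w = scal y I).
{ unfold Oim. rewrite Hx. unfold w, slice_pt, minus.
  rewrite plus_comm, plus_assoc, plus_opp_l, plus_zero_l. reflexivity. }
assert (Hnw : norm (Oim w) = Rabs y).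
{ rewrite Him.
  rewrite norm_Oscal, Hn. ring. }
split; [exact Hx|].
unfold slice_unit. rewrite Hnw, Him.
destruct (Req_EM_T (Rabs y) 0) as [Hy|Hy].
- split.
  + unfold imag_unit. unfold Omult, Oi, Qplus, Qopp, Qmult, Qconj, Cminus,
      Cplus, Copp, Cmult, Cconj; cbn [fst snd].
    change (opp Oone) with
      ((((- (1), - 0), (- 0, - 0)), ((- 0, - 0), (- 0, - 0))) : Quat * Quat).
    repeat apply f_equal2; ring.
  + rewrite Hy. assert (y = 0) as -> by (destruct (Req_dec y 0) as [|N];
      [assumption|now apply Rabs_no_R0 in N]).
    transitivity (zero : Oct_NM); [|symmetry].
    * exact (scal_zero_l (K := R_AbsRing) (Oi : Oct_NM)).
    * exact (scal_zero_l (K := R_AbsRing) (I : Oct_NM)).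
- rewrite (scal_assoc (/ Rabs y) y I). split.
  + apply imag_unit_scal; [exact HI|].
    change (/ Rabs y * y * (/ Rabs y * y) = 1).
    replace (/ Rabs y * y * (/ Rabs y * y)) with (y * y * / (Rabs y * Rabs y))
      by (field; exact Hy).
    rewrite <- Rabs_mult, Rabs_pos_eq by apply Rle_0_sqr.
    field. intros ->. apply Hy, Rabs_R0.
  + rewrite (scal_assoc (Rabs y) (mult (/ Rabs y) y) I). f_equal.
    change (Rabs y * (/ Rabs y * y) = y). field. exact Hy.
Qed.

Lemma slice_derivE (Omega : Oct -> Prop) (f : Oct -> Oct) (I : Oct) (x y : R) :
  slice_regular Omega f -> imag_unit I -> Omega (slice_pt I x y) ->
  slice_deriv f (slice_pt I x y) =
  scal (1 / 2) (minus (slice_dx f I x y) (Omult I (slice_dy f I x y))).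
Proof.
intros Hf HI HO.
destruct (slice_unit_correct I x y HI) as (Hx & HJ & Hy).
unfold slice_deriv. rewrite Hx.
set (J := slice_unit _) in *. set (v := norm _) in *.
assert (same : forall t : R, slice_pt J t v = slice_pt I t y).
{ intros t. unfold slice_pt. now rewrite Hy. }
assert (Edx : slice_dx f J x v = slice_dx f I x y).
{ unfold slice_dx, Oderive, Qderive, Cderive.
  repeat (first [apply Derive_ext; intros t; now rewrite same
                | apply f_equal2]). }
assert (cancel : forall (G : AbelianGroup) (u w : G),
    plus (plus u (opp w)) (plus u w) = plus u u).
{ intros G u w. rewrite (plus_comm u w), plus_assoc.
  apply (f_equal (fun v' => plus v' u)). rewrite <- (plus_assoc u (opp w) w).
  exact (eq_trans (f_equal (plus u) (plus_opp_l w)) (plus_zero_r u)). }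
assert (half : forall (V : ModuleSpace R_Ring) (u w : V),
    scal (1 / 2) (plus u w) = zero ->
    scal (1 / 2) (minus u w) = u).
{ intros V u w H.
  assert (two : plus (1 / 2) (1 / 2) = (one : R_Ring)).
  { change (1 / 2 + 1 / 2 = 1). field. }
  assert (twice : forall v' : V, scal (1 / 2) (plus v' v') = v').
  { intros v'. rewrite (scal_distr_l).
    rewrite <- (scal_distr_r). 
    exact (eq_trans (f_equal (fun k : R_Ring => scal k v') two) (scal_one v')). }
  rewrite <- (plus_zero_r (scal _ _)), <- H, <- (scal_distr_l).
  rewrite <- (twice u) at 3. f_equal. 
  exact (cancel (ModuleSpace.AbelianGroup R_Ring V) u w). }
destruct (Hf I HI x y HO) as (_ & _ & _ & _ & RI).
rewrite <- same in HO.
destruct (Hf J HJ x v HO) as (_ & _ & _ & _ & RJ).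
exact (eq_trans (half Oct_NM _ _ RJ) (eq_trans Edx (eq_sym (half Oct_NM _ _ RI)))).
Qed.

Lemma diameter_is_lub (A : Oct -> Prop) (M : R) :
  (exists w : Oct, A w) -> (forall w : Oct, A w -> norm w <= M) ->
  is_lub (fun r => exists z w : Oct, A z /\ A w /\ r = norm (minus z w))
    (diameter A).
Proof.
intros [w0 Hw0] HM.
unfold diameter.
set (E := fun r => _).
assert (H0 : E 0).
{ exists w0, w0; repeat split; trivial.
  rewrite minus_eq_zero. symmetry. exact (@norm_zero R_AbsRing Oct_NM). }
assert (HE : forall r, E r -> r <= 2 * M).
{ intros r (z & w & Hz & Hw & ->).
  pose proof (norm_triangle z (opp w)) as T.
  rewrite (norm_opp w) in T.
  change (norm (plus z (opp w))) with (norm (minus z w)) in T. pose proof (HM z Hz). pose proof (HM w Hw). lra. }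
destruct (Lub_Rbar_correct E) as [ub lub].
pose proof (ub 0 H0) as L0.
assert (LM : Rbar_le (Lub_Rbar E) (2 * M)).
{ apply lub. intros r Hr. exact (HE r Hr). }
destruct (Lub_Rbar E) as [s | |]; try (now destruct LM); try (now destruct L0).
split.
- intros r Hr. exact (ub r Hr).
- intros b Hb. exact (lub (Finite b) (fun r Hr => Hb r Hr)).
Qed.

(* Main.v *)
Require Import Defs.
From Stdlib Require Import Reals Factorial Lra Lia ZArith.
From Coquelicot Require Import Coquelicot.
Open Scope R_scope.

(** Left multiplication by an imaginary unit I turns the octonions into a complex
    vector space on which [f_I] is holomorphic, so Cauchy's formula gives
    [f(z) = sum z^n a_n] on every slice, with the same [a_n = f^(n)(0) / n!] read
    off the real axis. The difference [f(z) - f(z e^(I theta))] has norm at most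
    [d] and coefficients [(1 - e^(I k theta)) a_k]; for [theta = pi / n] the n-th
    one is [2 a_n], which gives the bound.

    In the equality case, testing this difference on circles against
    [z^n a_n + epsilon z^k q] forces [a_k = 0] unless [e^(I k pi / n) = 1]. For the
    remaining [k >= 2 n] take [theta = (pi + delta) / n] and test against
    [w(z) z^n a_n], with a nonnegative weight [w] of mean 1 and frequency [k - n]: to
    first order in [delta], [a_k] is orthogonal to [C_I a_n]. Some slice [C_I]
    contains [a_k a_n^(-1)], so [a_k = 0]. A single slice would not do: for [c] of
    norm 1 orthogonal to [C_I], [z + z^2 c / 2] has diameter 2 on the disc. *)

(** The values are eight-dimensional and multiplication is not associative, so the analysis is done
    on scalars. For fixed I and p the functional q -> <q, p> + i <q, I p> is C_I-linear, because
    left multiplication by I is skew for the inner product and squares to -1. Composed with f_I it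
    gives an ordinary holomorphic function; letting p vary recovers the octonions.

    The angle pi / n is blind to the frequencies k with e^(I k pi / n) = 1, since the rotated
    difference cancels them. Tilting by delta costs only second order at frequency n, where the
    factor 2 becomes 1 + cos delta, while the k-th term reappears at first order; a phase in the
    weight makes that first order a gain, which the bound d forbids. The weighted test function has
    frequencies n, k and 2 n - k. As k >= 2 n, the last is not positive, and there the difference
    contributes nothing: its constant term is cancelled and it has no negative frequencies. Thus a_n
    and a_k are isolated. *)

Lemma continuity_2d_pt_comp (f X Y : R -> R -> R) (a b : R) :
  continuity_2d_pt f (X a b) (Y a b) ->
  continuity_2d_pt X a b -> continuity_2d_pt Y a b ->
  continuity_2d_pt (fun l t => f (X l t) (Y l t)) a b.
Proof.
intros Hf HX HY eps. destruct (Hf eps) as [d Hd].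
destruct (HX d) as [d1 H1], (HY d) as [d2 H2].
assert (Hm : 0 < Rmin d1 d2) by (apply Rmin_pos; apply cond_pos).
exists (mkposreal _ Hm); intros l t Hl Ht; simpl in *.
apply Hd; [apply H1 | apply H2]; eapply Rlt_le_trans; try eassumption;
  (apply Rmin_l || apply Rmin_r).
Qed.

Lemma continuity_2d_pt_snd (f : R -> R) (a b : R) :
  continuous f b -> continuity_2d_pt (fun _ t => f t) a b.
Proof.
intros Hf. apply (continuity_1d_2d_pt_comp f (fun _ t => t)).
- apply continuity_pt_filterlim. exact Hf.
- apply continuity_2d_pt_id2.
Qed.

Lemma continuity_2d_pt_slice (f : R -> R -> R) (a b : R) :
  continuity_2d_pt f a b -> continuous (fun t => f a t) b.
Proof.
intros H. apply continuity_pt_filterlim.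
intros eps He. destruct (H (mkposreal eps He)) as [d Hd].
exists d; split; [apply cond_pos|].
intros t [_ Ht]. apply Hd; [|exact Ht].
rewrite Rminus_eq_0, Rabs_R0. apply cond_pos.
Qed.

(** * Holomorphic functions on the unit disc *)

(** [u + i v] is holomorphic with derivative [ux - i uy]. *)
Definition holomorphic_disc (u v ux uy : R -> R -> R) : Prop :=
  forall x y : R, x ^ 2 + y ^ 2 < 1 ->
    differentiable_pt_lim u x y (ux x y) (uy x y) /\
    differentiable_pt_lim v x y (- uy x y) (ux x y) /\
    continuity_2d_pt ux x y /\ continuity_2d_pt uy x y.

Lemma differentiable_pt_lim_opp (f : R -> R -> R) (x y lx ly : R) :
  differentiable_pt_lim f x y lx ly ->
  differentiable_pt_lim (fun a b => - f a b) x y (- lx) (- ly).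
Proof.
intros H eps. destruct (H eps) as [d Hd]. exists d. intros a b Ha Hb.
replace (- f a b - - f x y - (- lx * (a - x) + - ly * (b - y)))
  with (- (f a b - f x y - (lx * (a - x) + ly * (b - y)))) by ring.
rewrite Rabs_Ropp. now apply Hd.
Qed.

(** Multiplication by -i: it turns statements about real parts of coefficients into statements about
    imaginary parts. *)
Lemma holomorphic_disc_rotate (u v ux uy : R -> R -> R) :
  holomorphic_disc u v ux uy ->
  holomorphic_disc v (fun x y => - u x y) (fun x y => - uy x y) ux.
Proof.
intros H x y Hxy. destruct (H x y Hxy) as (H1 & H2 & H3 & H4).
repeat split; trivial.
- now apply differentiable_pt_lim_opp.
- now apply continuity_2d_pt_opp.
Qed.

Lemma continuous_cos_mult (r x : R) : continuous (fun t => r * cos t) x.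
Proof. apply (continuous_scal_r (V := R_NormedModule) r cos), continuous_cos. Qed.

Lemma continuous_sin_mult (r x : R) : continuous (fun t => r * sin t) x.
Proof. apply (continuous_scal_r (V := R_NormedModule) r sin), continuous_sin. Qed.

(** Differentiation under the integral needs a neighbourhood of every [l], the end points 0 and 1
    included, so [m] may leave [0, 1]. The modulus of the point is at most
    [Rabs (1 - m) * rho + Rabs m * r], uniformly in [t]. *)
Lemma segment_in_disc (x0 y0 r l : R) :
  0 < r -> r < 1 -> x0 ^ 2 + y0 ^ 2 < r ^ 2 -> 0 <= l <= 1 ->
  locally l (fun m => forall t,
    (x0 + m * (r * cos t - x0)) ^ 2 + (y0 + m * (r * sin t - y0)) ^ 2 < 1).
Proof.
intros r0 r1 zr Hl.
set (rho := sqrt (x0 ^ 2 + y0 ^ 2)).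
assert (Hrho : 0 <= rho) by apply sqrt_pos.
assert (Erho : rho ^ 2 = x0 ^ 2 + y0 ^ 2).
{ unfold rho. apply pow2_sqrt. apply Rplus_le_le_0_compat; apply pow2_ge_0. }
assert (Hlt : rho < r).
{ apply Rsqr_incrst_0; unfold Rsqr; lra. }
(* The margin (1 - r) / 3 is small enough because r (1 + 2 (1 - r) / 3) = 1 - (1 - r) (1 - 2 r / 3)
   < 1. *)
assert (He : 0 < (1 - r) / 3) by lra.
exists (mkposreal _ He). intros m Hm t.
change (Rabs (m - l) < (1 - r) / 3) in Hm. apply Rabs_lt_between in Hm.
assert (Hcs : cos t ^ 2 + sin t ^ 2 = 1).
{ rewrite <- !Rsqr_pow2, Rplus_comm. apply sin2_cos2. }
set (c := cos t) in *; set (s := sin t) in *.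
assert (Hdot : Rabs (x0 * c + y0 * s) <= rho).
{ rewrite <- (Rabs_pos_eq rho Hrho). apply Rsqr_le_abs_0. unfold Rsqr.
  replace (rho * rho) with ((x0 ^ 2 + y0 ^ 2) * (c ^ 2 + s ^ 2)) by (rewrite Hcs; lra).
  pose proof (pow2_ge_0 (x0 * s - y0 * c)). lra. }
assert (Hxy : (x0 + m * (r * c - x0)) ^ 2 + (y0 + m * (r * s - y0)) ^ 2 =
  (1 - m) ^ 2 * rho ^ 2 + 2 * ((1 - m) * m * r) * (x0 * c + y0 * s) + m ^ 2 * r ^ 2).
{ rewrite Erho.
  replace (m ^ 2 * r ^ 2) with (m ^ 2 * r ^ 2 * (c ^ 2 + s ^ 2)) by (rewrite Hcs; ring).
  ring. }
pose proof (Rabs_pos (1 - m)) as P1; pose proof (Rabs_pos m) as P2.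
assert (Hb : (x0 + m * (r * c - x0)) ^ 2 + (y0 + m * (r * s - y0)) ^ 2
  <= (Rabs (1 - m) * rho + Rabs m * r) ^ 2).
{ rewrite Hxy.
  replace ((Rabs (1 - m) * rho + Rabs m * r) ^ 2) with
    (Rabs (1 - m) ^ 2 * rho ^ 2 + 2 * (Rabs (1 - m) * Rabs m * r * rho)
     + Rabs m ^ 2 * r ^ 2) by ring.
  rewrite !pow2_abs.
  assert ((1 - m) * m * r * (x0 * c + y0 * s) <= Rabs (1 - m) * Rabs m * r * rho).
  { eapply Rle_trans; [apply Rle_abs|].
    rewrite !Rabs_mult, (Rabs_pos_eq r) by lra.
    apply Rmult_le_compat_l; [|exact Hdot].
    apply Rmult_le_pos; [apply Rmult_le_pos|]; lra. }
  lra. }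
assert (Hs : 0 <= Rabs (1 - m) * rho + Rabs m * r < 1).
{ split; [apply Rplus_le_le_0_compat; apply Rmult_le_pos; lra|].
  assert (Rabs (1 - m) * rho <= Rabs (1 - m) * r) by (apply Rmult_le_compat_l; lra).
  assert (Rabs (1 - m) + Rabs m <= 1 + 2 * ((1 - r) / 3)).
  { unfold Rabs. destruct (Rcase_abs (1 - m)), (Rcase_abs m); lra. }
  assert ((Rabs (1 - m) + Rabs m) * r <= (1 + 2 * ((1 - r) / 3)) * r)
    by (apply Rmult_le_compat_r; lra).
  assert (0 < (1 - r) * (1 - 2 / 3 * r)) by (apply Rmult_lt_0_compat; lra).
  lra. }
eapply Rle_lt_trans; [exact Hb|]. apply pow_lt_1_compat; [exact Hs|lia].
Qed.

(** * Cauchy's formula by contracting the circle *)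

Section CauchyFormula.

Context (u v ux uy : R -> R -> R) (x0 y0 r : R) (k1 k2 : R -> R).
Hypothesis (Hol : holomorphic_disc u v ux uy).
Hypothesis (r0 : 0 < r) (r1 : r < 1) (zr : x0 ^ 2 + y0 ^ 2 < r ^ 2).
Hypothesis (ck1 : forall t, continuous k1 t) (ck2 : forall t, continuous k2 t).
(** [k1 + i k2] is the kernel [r e^(it) / (r e^(it) - z)]. *)
Hypothesis
  (Hk1 : forall t, (r * cos t - x0) * k1 t - (r * sin t - y0) * k2 t = r * cos t)
  (Hk2 : forall t, (r * cos t - x0) * k2 t + (r * sin t - y0) * k1 t = r * sin t).

Let X (l t : R) : R := x0 + l * (r * cos t - x0).
Let Y (l t : R) : R := y0 + l * (r * sin t - y0).
Let G (l t : R) : R := u (X l t) (Y l t) * k1 t - v (X l t) (Y l t) * k2 t.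
(** The real part of f' times r e^(it): in the [l]-derivative of [G] the kernel cancels its
    denominator r e^(it) - z. *)
Let dG (l t : R) : R := ux (X l t) (Y l t) * (r * cos t) + uy (X l t) (Y l t) * (r * sin t).

Let inside (l : R) : Prop := forall t, X l t ^ 2 + Y l t ^ 2 < 1.

Let inside_segment (l : R) : 0 <= l <= 1 -> locally l inside.
Proof. exact (segment_in_disc x0 y0 r l r0 r1 zr). Qed.

Let continuity_XY (f : R -> R -> R) (l t : R) :
  continuity_2d_pt f (X l t) (Y l t) ->
  continuity_2d_pt (fun l t => f (X l t) (Y l t)) l t.
Proof.
intros Hf. apply continuity_2d_pt_comp; [exact Hf| |];
  unfold X, Y; apply continuity_2d_pt_plus; try apply continuity_2d_pt_const;
  apply continuity_2d_pt_mult; try apply continuity_2d_pt_id1;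
  apply continuity_2d_pt_minus; try apply continuity_2d_pt_const.
- apply (continuity_2d_pt_snd (fun t => r * cos t)), continuous_cos_mult.
- apply (continuity_2d_pt_snd (fun t => r * sin t)), continuous_sin_mult.
Qed.

Let continuity_hol (l t : R) : inside l ->
  continuity_2d_pt u (X l t) (Y l t) /\ continuity_2d_pt v (X l t) (Y l t) /\
  continuity_2d_pt ux (X l t) (Y l t) /\ continuity_2d_pt uy (X l t) (Y l t).
Proof.
intros Hl. destruct (Hol _ _ (Hl t)) as (H1 & H2 & H3 & H4).
repeat split; trivial; apply differentiable_continuity_pt; red; eauto.
Qed.

Let continuity_dG (l t : R) : inside l -> continuity_2d_pt dG l t.
Proof.
intros Hl. destruct (continuity_hol l t Hl) as (_ & _ & C1 & C2).
unfold dG. apply continuity_2d_pt_plus; apply continuity_2d_pt_mult;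
  try now apply continuity_XY.
- apply (continuity_2d_pt_snd (fun t => r * cos t)), continuous_cos_mult.
- apply (continuity_2d_pt_snd (fun t => r * sin t)), continuous_sin_mult.
Qed.

Let is_derive_G (l t : R) : inside l -> is_derive (fun l => G l t) l (dG l t).
Proof.
intros Hl. destruct (Hol _ _ (Hl t)) as (H1 & H2 & _ & _).
assert (DX : derivable_pt_lim (fun l => X l t) l (r * cos t - x0)).
{ apply is_derive_Reals. unfold X. auto_derive; trivial; ring. }
assert (DY : derivable_pt_lim (fun l => Y l t) l (r * sin t - y0)).
{ apply is_derive_Reals. unfold Y. auto_derive; trivial; ring. }
pose proof (derivable_pt_lim_comp_2d u _ _ l _ _ _ _ H1 DX DY) as Du.
pose proof (derivable_pt_lim_comp_2d v _ _ l _ _ _ _ H2 DX DY) as Dv.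
apply is_derive_Reals in Du. apply is_derive_Reals in Dv.
unfold G. evar_last.
{ apply (is_derive_minus (V := R_NormedModule));
    [apply (is_derive_scal_l (V := R_NormedModule) _ _ _ (k1 t) Du)
    |apply (is_derive_scal_l (V := R_NormedModule) _ _ _ (k2 t) Dv)]. }
unfold dG.
transitivity (ux (X l t) (Y l t) * ((r * cos t - x0) * k1 t - (r * sin t - y0) * k2 t)
  + uy (X l t) (Y l t) * ((r * cos t - x0) * k2 t + (r * sin t - y0) * k1 t)).
- unfold minus, plus, opp, scal, mult; simpl; unfold mult; simpl; ring.
- now rewrite Hk1, Hk2.
Qed.

(** By the Cauchy-Riemann equations [l * dG l t] is the [t]-derivative of [v] along a closed curve.
    Dividing by [l] excludes the degenerate circle; the mean value theorem evaluates at interior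
    points of [0, 1] only. *)
Let integral_dG (l : R) : inside l -> l <> 0 -> RInt (dG l) 0 (2 * PI) = 0.
Proof.
intros Hl Nl.
assert (D : forall t, is_derive (fun t => v (X l t) (Y l t)) t (l * dG l t)).
{ intros t. destruct (Hol _ _ (Hl t)) as (_ & H2 & _ & _).
  assert (DX : derivable_pt_lim (fun t => X l t) t (l * (- r * sin t))).
  { apply is_derive_Reals. unfold X. auto_derive; trivial; ring. }
  assert (DY : derivable_pt_lim (fun t => Y l t) t (l * (r * cos t))).
  { apply is_derive_Reals. unfold Y. auto_derive; trivial; ring. }
  pose proof (derivable_pt_lim_comp_2d v _ _ t _ _ _ _ H2 DX DY) as Dv.
  apply is_derive_Reals in Dv. evar_last; [exact Dv|]. unfold dG. ring. }
assert (I : is_RInt (fun t => l * dG l t) 0 (2 * PI)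
  (minus (v (X l (2 * PI)) (Y l (2 * PI))) (v (X l 0) (Y l 0)))).
{ apply (is_RInt_derive (V := R_CompleteNormedModule) (fun t => v (X l t) (Y l t))).
  - intros t _. apply D.
  - intros t _. apply (continuous_scal_r (V := R_NormedModule) l (dG l)).
    apply continuity_2d_pt_slice, continuity_dG, Hl. }
assert (E : v (X l (2 * PI)) (Y l (2 * PI)) = v (X l 0) (Y l 0)).
{ unfold X, Y. now rewrite cos_2PI, sin_2PI, cos_0, sin_0. }
rewrite E, minus_eq_zero in I.
apply (is_RInt_scal (V := R_NormedModule) _ _ _ (/ l)) in I.
transitivity (scal (/ l) (zero : R_NormedModule)); [|exact (Rmult_0_r (/ l))].
apply is_RInt_unique. eapply is_RInt_ext; [|exact I].
intros t _. unfold scal; simpl; unfold mult; simpl. now field.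
Qed.

Let is_derive_RInt_G (l : R) : 0 <= l <= 1 ->
  is_derive (fun l => RInt (G l) 0 (2 * PI)) l (RInt (dG l) 0 (2 * PI)).
Proof.
intros Hl. pose proof (inside_segment l Hl) as L.
pose proof (locally_singleton _ _ L) as Ll.
evar_last.
{ apply (is_derive_RInt_param G 0 (2 * PI) l).
  - apply (filter_imp inside); [|exact L]. intros m Hm t _. eexists. now apply is_derive_G.
  - intros t _. apply (continuity_2d_pt_ext_loc dG); [|now apply continuity_dG].
    destruct L as [e He]. exists e. intros m s Hm _. symmetry.
    apply is_derive_unique, is_derive_G, He, Hm.
  - apply (filter_imp inside); [|exact L]. intros m Hm.
    apply (ex_RInt_continuous (V := R_CompleteNormedModule)). intros t _.
    apply (continuity_2d_pt_slice G). destruct (continuity_hol m t Hm) as (C1 & C2 & _ & _).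
    unfold G. apply continuity_2d_pt_minus; apply continuity_2d_pt_mult;
    try (now apply continuity_XY); now apply continuity_2d_pt_snd. }
apply RInt_ext. intros t _. now apply is_derive_unique, is_derive_G.
Qed.

(* Shrinking the circle to [z] leaves the integral unchanged: its derivative in
   the homotopy parameter is the integral of a derivative along the circle. *)
Lemma cauchy_formula :
  RInt (fun t => u (r * cos t) (r * sin t) * k1 t - v (r * cos t) (r * sin t) * k2 t)
    0 (2 * PI)
  = RInt (fun t => u x0 y0 * k1 t - v x0 y0 * k2 t) 0 (2 * PI).
Proof.
assert (E1 : forall t, X 1 t = r * cos t) by (intros; unfold X; ring).
assert (E2 : forall t, Y 1 t = r * sin t) by (intros; unfold Y; ring).
assert (E3 : forall t, X 0 t = x0) by (intros; unfold X; ring).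
assert (E4 : forall t, Y 0 t = y0) by (intros; unfold Y; ring).
transitivity (RInt (G 1) 0 (2 * PI)).
{ apply RInt_ext. intros t _. unfold G. now rewrite E1, E2. }
transitivity (RInt (G 0) 0 (2 * PI)).
2:{ apply RInt_ext. intros t _. unfold G. now rewrite E3, E4. }
assert (Z : forall l, 0 < l <= 1 -> RInt (dG l) 0 (2 * PI) = 0).
{ intros l Hl. apply integral_dG; [|lra]. apply (locally_singleton l), inside_segment. lra. }
destruct (MVT_cor2 (fun l => RInt (G l) 0 (2 * PI))
  (fun l => RInt (dG l) 0 (2 * PI)) 0 1) as (c & E & Hc); [lra| |].
- intros l Hl. apply is_derive_Reals, is_derive_RInt_G. exact Hl.
- rewrite Z in E by lra. lra.
Qed.

End CauchyFormula.

(** * Integration term by term on the circle *)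

Definition cis (t : R) : C := (cos t, sin t).

Lemma cis_plus (s t : R) : cis (s + t) = (cis s * cis t)%C.
Proof.
unfold cis, Cmult; simpl. now rewrite cos_plus, sin_plus, (Rplus_comm (sin s * cos t)).
Qed.

Lemma cis_0 : cis 0 = RtoC 1.
Proof. unfold cis. now rewrite cos_0, sin_0. Qed.

Lemma Cmod_cis (t : R) : Cmod (cis t) = 1.
Proof.
unfold Cmod, cis; simpl fst; simpl snd.
rewrite <- !Rsqr_pow2, Rplus_comm, sin2_cos2. apply sqrt_1.
Qed.

Lemma cis_pow (t : R) (n : nat) : (cis t ^ n)%C = cis (INR n * t).
Proof.
induction n as [|n IH].
- simpl Cpow. now rewrite Rmult_0_l, cis_0.
- rewrite Cpow_S, IH, <- cis_plus, S_INR. f_equal. ring.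
Qed.

Lemma is_series_RInt (f : nat -> R -> R) (g : R -> R) (I M : nat -> R) (a b : R) :
  a <= b -> (forall n, is_RInt (f n) a b (I n)) ->
  (forall n t, a <= t <= b -> Rabs (sum_n (fun k => f k t) n - g t) <= M n) ->
  is_lim_seq M 0 ->
  ex_RInt g a b /\ is_series I (RInt g a b).
Proof.
intros Hab HI HM Hlim.
(* [filterlim_RInt] asks for uniform convergence on the whole line; with every function cut off
   outside [a, b], the bound on [a, b] suffices. *)
set (cut := fun (h : R -> R) (t : R) =>
  if Rle_dec a t then if Rle_dec t b then h t else 0 else 0).
assert (Ecut : forall h t, Rmin a b < t < Rmax a b -> cut h t = h t).
{ intros h t Ht. rewrite Rmin_left, Rmax_right in Ht by lra. unfold cut.
  destruct (Rle_dec a t); [|lra]. destruct (Rle_dec t b); [reflexivity|lra]. }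
assert (HS : forall n, is_RInt (fun t => sum_n (fun k => f k t) n) a b (sum_n I n)).
{ induction n as [|n IH].
  - rewrite sum_O. eapply is_RInt_ext; [|apply (HI 0%nat)]. intros t _. now rewrite sum_O.
  - rewrite sum_Sn. eapply is_RInt_ext; [|exact (is_RInt_plus _ _ _ _ _ _ IH (HI (S n)))].
    intros t _. now rewrite sum_Sn. }
destruct (filterlim_RInt (V := R_CompleteNormedModule)
  (fun n => cut (fun t => sum_n (fun k => f k t) n)) a b eventually _
  (cut g) (sum_n I)) as (If & H1 & H2).
- intros n. eapply is_RInt_ext; [|apply HS]. intros t Ht. symmetry. now apply Ecut.
- intros P [e He]. apply is_lim_seq_spec in Hlim. destruct (Hlim e) as [N HN].
  exists N. intros n Hn. apply He. intros t.
  change (Rabs (cut (fun t => sum_n (fun k => f k t) n) t - cut g t) < e).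
  unfold cut.
  destruct (Rle_dec a t); [destruct (Rle_dec t b)|];
    try (rewrite Rminus_eq_0, Rabs_R0; apply cond_pos).
  eapply Rle_lt_trans; [apply HM; lra|].
  specialize (HN n Hn). rewrite Rminus_0_r in HN. eapply Rle_lt_trans; [apply Rle_abs|exact HN].
- assert (H3 : is_RInt g a b If).
  { eapply is_RInt_ext; [|exact H2]. intros t Ht. now apply Ecut. }
  split; [now exists If|]. now rewrite (is_RInt_unique _ _ _ _ H3).
Qed.

Lemma is_RInt_trig (l : Z) (a b : R) :
  is_RInt (fun t => a * cos (IZR l * t) + b * sin (IZR l * t)) 0 (2 * PI)
    (if Z.eq_dec l 0 then 2 * PI * a else 0).
Proof.
destruct (Z.eq_dec l 0) as [->|Hl].
- replace (2 * PI * a) with (scal (2 * PI - 0) a) by (unfold scal; simpl; unfold mult; simpl; ring).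
  eapply is_RInt_ext; [|apply (is_RInt_const (V := R_NormedModule))].
  intros t _. simpl. rewrite Rmult_0_l, cos_0, sin_0. ring.
- assert (Nl : IZR l <> 0) by now apply not_0_IZR.
  set (F := fun t => a * sin (IZR l * t) / IZR l - b * cos (IZR l * t) / IZR l).
  replace 0 with (minus (F (2 * PI)) (F 0)) at 2.
  + apply (is_RInt_derive (V := R_CompleteNormedModule) F).
    * intros t _. unfold F. auto_derive; trivial. now field.
    * intros t _. apply (ex_derive_continuous (V := R_NormedModule)). auto_derive; trivial.
  + unfold F, minus, plus, opp; simpl. rewrite Rmult_0_r.
    assert (E : forall x, cos (x + IZR l * (2 * PI)) = cos x /\ sin (x + IZR l * (2 * PI)) = sin x).
    { intros x. assert (P : forall n y, cos (y + INR n * (2 * PI)) = cos y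
        /\ sin (y + INR n * (2 * PI)) = sin y).
      { intros n y. replace (y + INR n * (2 * PI)) with (y + 2 * INR n * PI) by ring.
        split; [apply cos_period|apply sin_period]. }
      (* The periods are counted by a natural number, so for negative [l] the shift by
         [Pos.to_nat p] periods leads back to [x]. *)
      destruct l as [|p|p]; [easy| |].
      - rewrite <- (positive_nat_Z p), <- INR_IZR_INZ. apply P.
      - destruct (P (Pos.to_nat p) (x + IZR (Z.neg p) * (2 * PI))) as [P1 P2].
        rewrite <- P1, <- P2.
        replace (x + _ + _) with x; [easy|].
        rewrite INR_IZR_INZ, positive_nat_Z. change (Z.neg p) with (- Z.pos p)%Z.
        rewrite opp_IZR. ring. }
    destruct (E 0) as [E1 E2]. rewrite Rplus_0_l in E1, E2. rewrite E1, E2.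
    ring.
Qed.

Lemma continuous_bounded (f : R -> R) (a b : R) :
  a <= b -> (forall t, continuous f t) -> exists M, forall t, a <= t <= b -> Rabs (f t) <= M.
Proof.
intros Hab Hf.
destruct (continuity_ab_maj (fun t => Rabs (f t)) a b Hab) as (m & Hm & _).
- intros t _. apply continuity_pt_filterlim.
  apply (continuous_comp f Rabs); [apply Hf|apply continuous_Rabs].
- now exists (Rabs (f m)).
Qed.

Lemma fst_Cplus (a b : C) : fst (a + b)%C = fst a + fst b.
Proof. reflexivity. Qed.

Lemma fst_Cminus (a b : C) : fst (a - b)%C = fst a - fst b.
Proof. reflexivity. Qed.

(** With q = z / r, the kernel r e^(it) / (r e^(it) - z) is 1 / (1 - q e^(-it)); its geometric
    series converges uniformly in [t] as |q| < 1. *)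
Lemma geometric_kernel (H1 H2 : R -> R) (q : C) (I : nat -> R) :
  Cmod q < 1 -> (forall t, continuous H1 t) -> (forall t, continuous H2 t) ->
  (forall n, is_RInt (fun t => fst ((H1 t, H2 t) * (q * cis (- t)) ^ n)%C) 0 (2 * PI) (I n)) ->
  is_series I (RInt (fun t => fst ((H1 t, H2 t) * / (1 - q * cis (- t)))%C) 0 (2 * PI)).
Proof.
intros Hq C1 C2 HI.
assert (HPI : 0 <= 2 * PI) by (pose proof PI_RGT_0; lra).
destruct (continuous_bounded H1 0 (2 * PI) HPI C1) as [M1 HM1].
destruct (continuous_bounded H2 0 (2 * PI) HPI C2) as [M2 HM2].
(* The remainder after the n-th term is h / (1 - w) times w^(n+1); the bound uses |h| <= sqrt 2
   max(|H1|, |H2|) and |1 - w| >= 1 - |q|. *)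
eapply (is_series_RInt (fun n t => fst ((H1 t, H2 t) * (q * cis (- t)) ^ n)%C) _ _
  (fun n => (sqrt 2 * (Rabs M1 + Rabs M2) * / (1 - Cmod q)) * Cmod q ^ S n));
  [exact HPI|exact HI| |].
- intros n t Ht. set (w := (q * cis (- t))%C). set (h := (H1 t, H2 t) : C).
  assert (Hw : Cmod w = Cmod q) by (unfold w; rewrite Cmod_mult, Cmod_cis; ring).
  assert (Nw : (1 - w)%C <> RtoC 0).
  { intros E. assert (w = RtoC 1).
    { replace w with (1 - (1 - w))%C by ring. rewrite E. ring. }
    rewrite H, Cmod_1 in Hw. lra. }
  assert (S : forall n, sum_n (fun k => fst (h * w ^ k)%C) n =
    fst (h * / (1 - w))%C - fst (h * / (1 - w) * w ^ S n)%C).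
  { clear n. intros n. induction n as [|n IH].
    - rewrite sum_O, <- fst_Cminus.
      f_equal. rewrite Cpow_1_r. simpl. field. exact Nw.
    - rewrite sum_Sn, IH. change plus with Rplus.
      rewrite <- !fst_Cminus, <- fst_Cplus.
      f_equal. rewrite (Cpow_S w (S n)). field. exact Nw. }
  rewrite S. fold w h.
  replace (fst (h * / (1 - w))%C - fst (h * / (1 - w) * w ^ Datatypes.S n)%C - fst (h * / (1 - w))%C)
    with (- fst (h * / (1 - w) * w ^ Datatypes.S n)%C) by ring.
  rewrite Rabs_Ropp. eapply Rle_trans; [apply re_le_Cmod|].
  rewrite !Cmod_mult, Cmod_pow, Hw, Cmod_inv by exact Nw.
  apply Rmult_le_compat_r; [apply pow_le, Cmod_ge_0|].
  assert (Hd : 1 - Cmod q <= Cmod (1 - w)).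
  { pose proof (Cmod_triangle (1 - w) w) as T. replace (1 - w + w)%C with (RtoC 1) in T by ring.
    rewrite Cmod_1, Hw in T. lra. }
  apply Rmult_le_compat.
  + apply Cmod_ge_0.
  + left. apply Rinv_0_lt_compat. lra.
  + eapply Rle_trans; [apply Cmod_2Rmax|]. apply Rmult_le_compat_l; [apply sqrt_pos|].
    simpl fst; simpl snd. specialize (HM1 t Ht). specialize (HM2 t Ht).
    pose proof (Rle_abs M1). pose proof (Rle_abs M2).
    pose proof (Rabs_pos M1). pose proof (Rabs_pos M2). apply Rmax_lub; lra.
  + apply Rinv_le_contravar; lra.
- replace (Finite 0) with (Rbar_mult (sqrt 2 * (Rabs M1 + Rabs M2) * / (1 - Cmod q)) 0)
    by (simpl; now rewrite Rmult_0_r).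
  apply is_lim_seq_scal_l, (is_lim_seq_incr_1 (fun n => Cmod q ^ n)), is_lim_seq_geom.
  rewrite Rabs_pos_eq; [exact Hq|apply Cmod_ge_0].
Qed.

(** * Taylor coefficients *)

Definition taylor (g : R -> R) (n : nat) : R := Derive_n g n 0 / INR (fact n).

Lemma taylor_unique (a : nat -> R) (g : R -> R) (r : R) :
  0 < r -> (forall x, Rabs x < r -> is_series (fun n => a n * x ^ n) (g x)) ->
  forall n, taylor g n = a n.
Proof.
intros Hr H n.
assert (Hrad : Rbar_lt 0 (CV_radius a)).
{ apply (Rbar_lt_le_trans _ (r / 2)); [simpl; lra|].
  apply Rbar_not_lt_le. intros L.
  rewrite <- (Rabs_pos_eq (r / 2)) in L by lra.
  apply (CV_disk_outside _ _ L).
  apply (ex_series_lim_0 (fun n => a n * (r / 2) ^ n)). eexists. apply H.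
  rewrite Rabs_pos_eq; lra. }
unfold taylor. rewrite (Derive_n_ext_loc g (PSeries a)), Derive_n_coef by
  (try exact Hrad; exists (mkposreal r Hr); intros x Hx; symmetry;
   apply is_series_unique, H; change (Rabs (x - 0) < r) in Hx; now rewrite Rminus_0_r in Hx).
field. apply INR_fact_neq_0.
Qed.

(** Retypes an equality stated over the carrier of an algebraic structure as one over [R], where
    [ring] applies. *)
Ltac eqR := match goal with |- @eq _ ?a ?b => change (@eq R a b) end.

Lemma is_series_finite (a : nat -> R) (N : nat) :
  (forall n, (N < n)%nat -> a n = 0) -> is_series a (sum_n a N).
Proof.
intros H. change (is_lim_seq (sum_n a) (sum_n a N)). apply is_lim_seq_spec. intros e. exists N. intros n Hn.
replace (sum_n a n) with (sum_n a N); [rewrite Rminus_eq_0, Rabs_R0; apply cond_pos|].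
induction Hn as [|n Hn IH]; [reflexivity|].
rewrite sum_Sn, <- IH, H by lia. symmetry. exact (Rplus_0_r _).
Qed.

Lemma continuous_circle (f : R -> R -> R) (r t : R) :
  continuity_2d_pt f (r * cos t) (r * sin t) ->
  continuous (fun t => f (r * cos t) (r * sin t)) t.
Proof.
intros Hf.
apply (continuity_2d_pt_slice (fun _ t => f (r * cos t) (r * sin t)) 0).
apply (continuity_2d_pt_comp f (fun _ t => r * cos t) (fun _ t => r * sin t)).
- exact Hf.
- apply (continuity_2d_pt_snd (fun t => r * cos t)), continuous_cos_mult.
- apply (continuity_2d_pt_snd (fun t => r * sin t)), continuous_sin_mult.
Qed.

Lemma circle_in_disc (r t : R) : 0 <= r < 1 -> (r * cos t) ^ 2 + (r * sin t) ^ 2 < 1.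
Proof.
intros Hr. replace ((r * cos t) ^ 2 + (r * sin t) ^ 2) with (r ^ 2 * (Rsqr (sin t) + Rsqr (cos t)))
  by (unfold Rsqr; ring).
rewrite sin2_cos2, Rmult_1_r. apply pow_lt_1_compat; [exact Hr|lia].
Qed.

Lemma Re_mult_kernel_pow (h q : C) (t : R) (n : nat) :
  fst (h * (q * cis (- t)) ^ n)%C =
  fst (q ^ n)%C * (fst h * cos (INR n * t) + snd h * sin (INR n * t))
  - snd (q ^ n)%C * (snd h * cos (INR n * t) - fst h * sin (INR n * t)).
Proof.
rewrite Cpow_mult_l, cis_pow. generalize (q ^ n)%C. intros w.
replace (INR n * - t) with (- (INR n * t)) by ring.
unfold cis. rewrite cos_neg, sin_neg. simpl. ring.
Qed.

(** This evaluates the right side of [cauchy_formula]: of the expanded kernel only the term [n = 0]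
    survives integration. *)
Lemma RInt_kernel_const (a b : R) (q : C) : Cmod q < 1 ->
  RInt (fun t => fst ((a, b) * / (1 - q * cis (- t)))%C) 0 (2 * PI) = 2 * PI * a.
Proof.
intros Hq.
set (I := fun n => match n with O => 2 * PI * a | S _ => 0 end).
transitivity (Series I).
- symmetry. apply is_series_unique.
  apply (geometric_kernel (fun _ => a) (fun _ => b) q I Hq);
    try (intros; apply continuous_const).
  intros n.
  replace (I n) with (if Z.eq_dec (Z.of_nat n) 0
    then 2 * PI * (fst (q ^ n)%C * a - snd (q ^ n)%C * b) else 0).
  + eapply is_RInt_ext; [|exact (is_RInt_trig (Z.of_nat n)
      (fst (q ^ n)%C * a - snd (q ^ n)%C * b) (fst (q ^ n)%C * b + snd (q ^ n)%C * a))].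
    intros t _. rewrite Re_mult_kernel_pow, <- INR_IZR_INZ. simpl fst; simpl snd. eqR. ring.
  + destruct (Z.eq_dec (Z.of_nat n) 0), n as [|n]; try lia; unfold I; simpl; ring.
- apply is_series_unique.
  replace (2 * PI * a) with (sum_n I 0) by now rewrite sum_O.
  apply is_series_finite. intros [|n] Hn; [lia|reflexivity].
Qed.

(** The real part of the n-th Cauchy coefficient of u + i v, the mean of f(r e^(it)) e^(-int) over
    r^n. The imaginary part is the same expression for the pair (v, -u). *)
Definition circle_coef (u v : R -> R -> R) (r : R) (n : nat) : R :=
  RInt (fun t => u (r * cos t) (r * sin t) * cos (INR n * t)
    + v (r * cos t) (r * sin t) * sin (INR n * t)) 0 (2 * PI) / (2 * PI * r ^ n).

(** Cauchy's formula with the kernel expanded in powers of [q]. The coefficients still refer to the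
    radius [r]. *)
Lemma is_series_circle_coef (u v ux uy : R -> R -> R) (r x y : R) :
  holomorphic_disc u v ux uy -> 0 < r < 1 -> x ^ 2 + y ^ 2 < r ^ 2 ->
  is_series (fun n => fst ((x, y) ^ n)%C * circle_coef u v r n
    - snd ((x, y) ^ n)%C * circle_coef v (fun a b => - u a b) r n) (u x y).
Proof.
intros Hol [r0 r1] zr.
pose proof PI_RGT_0 as HPI.
set (q := (x / r, y / r) : C).
assert (Hq : Cmod q < 1).
{ unfold Cmod. rewrite <- sqrt_1. apply sqrt_lt_1_alt. unfold q; simpl fst; simpl snd.
  split; [apply Rplus_le_le_0_compat; apply pow2_ge_0|].
  replace ((x / r) ^ 2 + (y / r) ^ 2) with ((x ^ 2 + y ^ 2) / r ^ 2) by (field; lra).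
  apply Rlt_div_l; [apply pow_lt, r0|lra]. }
assert (qx : fst q = x / r) by reflexivity. assert (qy : snd q = y / r) by reflexivity.
assert (Eqr : q = (RtoC (/ r) * (x, y))%C)
  by (unfold q, RtoC; apply injective_projections; simpl; field; lra).
clearbody q.
set (H1 := fun t => u (r * cos t) (r * sin t)).
set (H2 := fun t => v (r * cos t) (r * sin t)).
assert (C1 : forall t, continuous H1 t).
{ intros t. apply continuous_circle, differentiable_continuity_pt.
  destruct (Hol (r * cos t) (r * sin t)) as (D & _); [apply circle_in_disc; lra|]. red; eauto. }
assert (C2 : forall t, continuous H2 t).
{ intros t. apply continuous_circle, differentiable_continuity_pt.
  destruct (Hol (r * cos t) (r * sin t)) as (_ & D & _); [apply circle_in_disc; lra|]. red; eauto. }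
assert (Nw : forall t, (1 - q * cis (- t))%C <> RtoC 0).
{ intros t E. assert (Ew : (q * cis (- t))%C = RtoC 1).
  { replace (q * cis (- t))%C with (1 - (1 - q * cis (- t)))%C by ring. rewrite E. ring. }
  apply (f_equal Cmod) in Ew. rewrite Cmod_mult, Cmod_cis, Cmod_1 in Ew. lra. }
assert (Hd : forall t, 1 - Cmod q <= Cmod (1 - q * cis (- t))).
{ intros t. pose proof (Cmod_triangle (1 - q * cis (- t)) (q * cis (- t))) as T.
  replace (1 - q * cis (- t) + q * cis (- t))%C with (RtoC 1) in T by ring.
  rewrite Cmod_mult, Cmod_cis, Cmod_1 in T. lra. }
set (k := fun t => (/ (1 - q * cis (- t)))%C).
(* The squared modulus of [1 - q * cis (- t)], in real coordinates so that continuity of the kernel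
   can be left to [auto_derive]. *)
set (N2 := fun t => (1 - (fst q * cos t + snd q * sin t)) ^ 2 + (snd q * cos t - fst q * sin t) ^ 2).
assert (HN : forall t, 0 < N2 t).
{ intros t. specialize (Hd t). assert (P : 0 < Cmod (1 - q * cis (- t))) by lra.
  unfold Cmod in P. rewrite <- sqrt_0 in P. apply sqrt_lt_0_alt in P.
  eapply Rlt_le_trans; [exact P|right]. unfold N2, cis. rewrite cos_neg, sin_neg. simpl. ring. }
assert (Ek : forall t, k t = ((1 - (fst q * cos t + snd q * sin t)) / N2 t,
  (snd q * cos t - fst q * sin t) / N2 t)).
{ intros t. specialize (HN t). specialize (Nw t). unfold k.
  replace (1 - q * cis (- t))%C with ((1 - (fst q * cos t + snd q * sin t),
    - (snd q * cos t - fst q * sin t)) : C).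
  - unfold Cinv; simpl fst; simpl snd. fold (N2 t).
    replace ((1 - (fst q * cos t + snd q * sin t)) ^ 2 + (- (snd q * cos t - fst q * sin t)) ^ 2)
      with (N2 t) by (unfold N2; ring).
    f_equal. unfold Rdiv. ring.
  - unfold cis. rewrite cos_neg, sin_neg. apply injective_projections; simpl; ring. }
assert (ck1 : forall t, continuous (fun t => fst (k t)) t).
{ intros t. apply (continuous_ext (fun t => (1 - (fst q * cos t + snd q * sin t)) / N2 t)).
  { intros s. now rewrite Ek. }
  apply (ex_derive_continuous (V := R_NormedModule)). specialize (HN t). unfold N2 in *.
  auto_derive. lra. }
assert (ck2 : forall t, continuous (fun t => snd (k t)) t).
{ intros t. apply (continuous_ext (fun t => (snd q * cos t - fst q * sin t) / N2 t)).
  { intros s. now rewrite Ek. }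
  apply (ex_derive_continuous (V := R_NormedModule)). specialize (HN t). unfold N2 in *.
  auto_derive. lra. }
assert (Hk : forall t, ((r * cos t - x, r * sin t - y)%R * k t)%C = (r * cos t, r * sin t)).
{ intros t. replace ((r * cos t - x, r * sin t - y) : C) with
    ((r * cos t, r * sin t)%R * (1 - q * cis (- t)))%C.
  - unfold k. field. apply Nw.
  - assert (E : Rsqr (sin t) + Rsqr (cos t) = 1) by apply sin2_cos2. unfold Rsqr in E.
    unfold cis. rewrite cos_neg, sin_neg.
    apply injective_projections; simpl; rewrite qx, qy.
    + replace (r * cos t * (1 + - (x / r * cos t - y / r * - sin t)) - r * sin t * (0 + - (x / r * - sin t + y / r * cos t)))
        with (r * cos t - x * (sin t * sin t + cos t * cos t)) by (field; lra).
      rewrite E. ring.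
    + replace (r * cos t * (0 + - (x / r * - sin t + y / r * cos t)) + r * sin t * (1 + - (x / r * cos t - y / r * - sin t)))
        with (r * sin t - y * (sin t * sin t + cos t * cos t)) by (field; lra).
      rewrite E. ring. }
pose proof (cauchy_formula u v ux uy x y r (fun t => fst (k t)) (fun t => snd (k t))
  Hol r0 r1 zr ck1 ck2 (fun t => f_equal fst (Hk t)) (fun t => f_equal snd (Hk t))) as CF.
rewrite (RInt_ext (fun t => u x y * fst (k t) - v x y * snd (k t))
  (fun t => fst ((u x y, v x y) * k t)%C)) in CF by (intros; reflexivity).
unfold k at 3 in CF. rewrite RInt_kernel_const in CF by exact Hq.
set (A := circle_coef u v r). set (B := circle_coef v (fun a b => - u a b) r).
set (c := fun n => fst ((x, y) ^ n)%C * A n - snd ((x, y) ^ n)%C * B n).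
assert (HS : is_series (fun n => 2 * PI * c n)
  (RInt (fun t => fst ((H1 t, H2 t) * / (1 - q * cis (- t)))%C) 0 (2 * PI))).
{ apply (geometric_kernel H1 H2 q _ Hq C1 C2). intros n.
  assert (RI : forall f g : R -> R, (forall t, continuous f t) -> (forall t, continuous g t) ->
    is_RInt (fun t => f t * cos (INR n * t) + g t * sin (INR n * t)) 0 (2 * PI)
      (RInt (fun t => f t * cos (INR n * t) + g t * sin (INR n * t)) 0 (2 * PI))).
  { intros f g Hf Hg. apply (RInt_correct (V := R_CompleteNormedModule)).
    apply (ex_RInt_continuous (V := R_CompleteNormedModule)). intros t _.
    apply (continuous_plus (V := R_NormedModule) (fun t => f t * cos (INR n * t))
      (fun t => g t * sin (INR n * t)));
      apply (continuous_mult (K := R_AbsRing)); auto;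
      apply (ex_derive_continuous (V := R_NormedModule)); auto_derive; trivial. }
  pose proof (RI H1 H2 C1 C2) as IA.
  pose proof (RI H2 (fun t => - H1 t) C2
    (fun t => continuous_opp (V := R_NormedModule) H1 t (C1 t))) as IB.
  apply (is_RInt_scal _ _ _ (fst (q ^ n)%C)) in IA.
  apply (is_RInt_scal _ _ _ (snd (q ^ n)%C)) in IB.
  pose proof (is_RInt_minus _ _ _ _ _ _ IA IB) as IM.
  assert (Eq : (q ^ n)%C = (fst ((x, y) ^ n)%C / r ^ n, snd ((x, y) ^ n)%C / r ^ n)).
  { rewrite Eqr, Cpow_mult_l, <- RtoC_pow, pow_inv. unfold RtoC.
    apply injective_projections; simpl; field; apply pow_nonzero; lra. }
  replace (2 * PI * c n) with
    (minus (scal (fst (q ^ n)%C) (RInt (fun t => H1 t * cos (INR n * t) + H2 t * sin (INR n * t)) 0 (2 * PI)))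
       (scal (snd (q ^ n)%C) (RInt (fun t => H2 t * cos (INR n * t) + - H1 t * sin (INR n * t)) 0 (2 * PI)))).
  - eapply is_RInt_ext; [|exact IM]. intros t _. rewrite Re_mult_kernel_pow.
    unfold minus, plus, opp, scal; simpl; unfold mult; simpl. eqR. ring.
  - rewrite Eq. unfold c, A, B, circle_coef, H1, H2.
    unfold minus, plus, opp, scal; simpl; unfold mult; simpl. field.
    split; [apply pow_nonzero|]; lra. }
assert (E : RInt (fun t => fst ((H1 t, H2 t) * / (1 - q * cis (- t)))%C) 0 (2 * PI) = 2 * PI * u x y).
{ rewrite <- CF. apply RInt_ext. intros t _. reflexivity. }
rewrite E in HS. apply (is_series_scal_l (/ (2 * PI))) in HS.
replace (u x y) with (/ (2 * PI) * (2 * PI * u x y)) by (field; lra).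
eapply is_series_ext; [|exact HS]. intros n. cbv beta. change (scal ?a ?b) with (a * b).
unfold c. eqR. eqR. field. lra.
Qed.

(** On the real axis the preceding expansion is a real power series, so its coefficients are Taylor
    coefficients and no longer depend on the radius. *)
Theorem holomorphic_series (u v ux uy : R -> R -> R) (x y : R) :
  holomorphic_disc u v ux uy -> x ^ 2 + y ^ 2 < 1 ->
  is_series (fun n => fst ((x, y) ^ n)%C * taylor (fun s => u s 0) n
    - snd ((x, y) ^ n)%C * taylor (fun s => v s 0) n) (u x y).
Proof.
intros Hol Hxy.
set (rho := sqrt (x ^ 2 + y ^ 2)).
assert (Erho : rho ^ 2 = x ^ 2 + y ^ 2).
{ unfold rho. apply pow2_sqrt. apply Rplus_le_le_0_compat; apply pow2_ge_0. }
assert (Hrho : 0 <= rho) by apply sqrt_pos.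
assert (rho < 1) by (apply Rsqr_incrst_0; unfold Rsqr; lra).
(* Any radius strictly between |z| and 1 would do. *)
set (r := (1 + rho) / 2).
assert (Hr : 0 < r < 1) by (unfold r; lra).
assert (real : forall f g fx fy, holomorphic_disc f g fx fy ->
  forall n, taylor (fun s => f s 0) n = circle_coef f g r n).
{ intros f g fx fy Hf. apply (taylor_unique _ _ r); [lra|]. intros s Hs.
  eapply is_series_ext; [|apply (is_series_circle_coef _ _ _ _ r s 0 Hf Hr)].
  - intros n. change (@pair R R s (IZR Z0)) with (RtoC s). cbv beta. rewrite <- RtoC_pow. simpl. ring.
  - rewrite <- (Rabs_pos_eq r) in Hs by lra. apply Rsqr_lt_abs_1 in Hs.
    unfold Rsqr in Hs. simpl. lra. }
eapply is_series_ext; [|apply (is_series_circle_coef u v ux uy r x y Hol Hr)].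
- intros n. cbv beta. rewrite (real u v ux uy Hol), (real v _ _ _ (holomorphic_disc_rotate _ _ _ _ Hol)).
  reflexivity.
- rewrite <- Erho. assert (rho < r) by (unfold r; lra). simpl. rewrite !Rmult_1_r.
  apply Rmult_le_0_lt_compat; lra.
Qed.

(** * Power series on the unit disc *)

Definition disc_summable (a : nat -> R) : Prop := Rbar_le 1 (CV_radius a).

(** Outside its disc of convergence a power series has terms that do not tend to 0; a radius [s < 1]
    is refuted at the midpoint of [s] and 1. *)
Lemma disc_summable_intro (a : nat -> R) :
  (forall x, 0 < x < 1 -> is_lim_seq (fun n => a n * x ^ n) 0) -> disc_summable a.
Proof.
intros H. apply Rbar_not_lt_le. intros L.
pose proof (CV_radius_ge_0 a) as P.
destruct (CV_radius a) as [s| |] eqn:E; try easy. simpl in L, P.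
apply (CV_disk_outside a ((s + 1) / 2)).
- rewrite E. simpl. rewrite Rabs_pos_eq; lra.
- apply H. lra.
Qed.

Lemma disc_summable_abs (a : nat -> R) (x : R) :
  disc_summable a -> Rabs x < 1 -> ex_series (fun n => Rabs (a n * x ^ n)).
Proof.
intros H Hx. apply CV_disk_inside. eapply Rbar_lt_le_trans; [|exact H]. exact Hx.
Qed.

Lemma disc_summable_le (a b : nat -> R) (k : R) :
  disc_summable a -> (forall n, Rabs (b n) <= k * Rabs (a n)) -> disc_summable b.
Proof.
intros Ha H. apply disc_summable_intro. intros x Hx.
apply ex_series_lim_0, ex_series_Rabs.
apply (ex_series_le (V := R_CompleteNormedModule) _ (fun n => k * Rabs (a n * x ^ n))).
- intros n. change (norm (Rabs (b n * x ^ n))) with (Rabs (Rabs (b n * x ^ n))).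
  rewrite Rabs_Rabsolu, !Rabs_mult, <- Rmult_assoc.
  apply Rmult_le_compat_r; [apply Rabs_pos|apply H].
- apply (ex_series_scal (V := R_NormedModule) k), disc_summable_abs; [exact Ha|].
  rewrite Rabs_pos_eq; lra.
Qed.

Lemma disc_summable_plus (a b : nat -> R) :
  disc_summable a -> disc_summable b -> disc_summable (fun n => a n + b n).
Proof.
intros Ha Hb. apply (Rbar_le_trans _ (Rbar_min (CV_radius a) (CV_radius b))).
- apply Rbar_min_case; assumption.
- apply (CV_radius_plus a b).
Qed.

Lemma disc_summable_derive (a : nat -> R) :
  disc_summable a -> disc_summable (fun n => INR (S n) * a (S n)).
Proof.
intros Ha. unfold disc_summable.
change (Rbar_le 1 (CV_radius (PS_derive a))). now rewrite CV_radius_derive.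
Qed.

Definition Cnderiv (z : C) (n : nat) : C :=
  match n with O => 0 | S m => (RtoC (INR (S m)) * z ^ m)%C end.

(** The constant is the second derivative of rho^(n+2), so these bounds can be summed against the
    coefficients of a power series. The induction writes the remainder of exponent m + 1 as w times
    that of exponent m, plus m z^(m-1) (w - z)^2. *)
Lemma Cpow_taylor_remainder (z w : C) (rho : R) (n : nat) :
  Cmod z <= rho -> Cmod w <= rho ->
  Cmod (w ^ S (S n) - z ^ S (S n) - Cnderiv z (S (S n)) * (w - z))%C
  <= INR (S n) * INR (S (S n)) * rho ^ n * Cmod (w - z) ^ 2.
Proof.
intros Hz Hw.
assert (Hr : 0 <= rho) by (eapply Rle_trans; [apply Cmod_ge_0|exact Hz]).
induction n as [|n IH].
- replace (w ^ 2 - z ^ 2 - Cnderiv z 2 * (w - z))%C with ((w - z) ^ 2)%C.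
  + rewrite Cmod_pow. simpl (INR _). pose proof (pow2_ge_0 (Cmod (w - z))). simpl (rho ^ 0). lra.
  + unfold Cnderiv. replace (RtoC (INR 2)) with (1 + 1)%C.
    * simpl Cpow. ring.
    * simpl INR. rewrite RtoC_plus. reflexivity.
- replace (w ^ S (S (S n)) - z ^ S (S (S n)) - Cnderiv z (S (S (S n))) * (w - z))%C with
    (w * (w ^ S (S n) - z ^ S (S n) - Cnderiv z (S (S n)) * (w - z))
     + Cnderiv z (S (S n)) * (w - z) ^ 2)%C.
  + eapply Rle_trans; [apply Cmod_triangle|]. rewrite !Cmod_mult, Cmod_pow.
    unfold Cnderiv at 2.
    rewrite Cmod_mult, Cmod_R, (Rabs_pos_eq (INR _)), Cmod_pow by apply pos_INR.
    set (e := Cmod (w ^ S (S n) - _ - _)) in *. set (h := Cmod (w - z) ^ 2) in *.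
    assert (Hh : 0 <= h) by apply pow2_ge_0.
    assert (P : Cmod z ^ S n <= rho ^ S n) by (apply pow_incr; split; [apply Cmod_ge_0|exact Hz]).
    assert (0 <= e) by apply Cmod_ge_0.
    assert (H1 : Cmod w * e <= rho * (INR (S n) * INR (S (S n)) * rho ^ n * h)).
    { apply Rmult_le_compat; trivial. apply Cmod_ge_0. }
    assert (H2 : INR (S (S n)) * Cmod z ^ S n * h <= INR (S (S n)) * rho ^ S n * h).
    { apply Rmult_le_compat_r; [exact Hh|]. apply Rmult_le_compat_l; [apply pos_INR|exact P]. }
    rewrite (S_INR (S (S n))). rewrite (S_INR (S n)) in *. simpl pow in *.
    assert (0 <= (INR (S n) + 1) * (rho * rho ^ n) * h).
    { apply Rmult_le_pos; [|exact Hh]. pose proof (pos_INR (S n)).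
      apply Rmult_le_pos; [lra|]. apply Rmult_le_pos; [exact Hr|now apply pow_le]. }
    lra.
  + unfold Cnderiv. rewrite (S_INR (S (S n))), RtoC_plus. simpl Cpow. ring.
Qed.

Definition re_series (c : nat -> C) (x y : R) : R := Series (fun n => fst ((x, y) ^ n * c n)%C).

Definition coef_derive (c : nat -> C) (n : nat) : C := (RtoC (INR (S n)) * c (S n))%C.

Lemma disc_summable_coef_derive (c : nat -> C) :
  disc_summable (fun n => Cmod (c n)) -> disc_summable (fun n => Cmod (coef_derive c n)).
Proof.
intros H. apply (disc_summable_le (fun n => INR (S n) * Cmod (c (S n))) _ 1).
- exact (disc_summable_derive (fun n => Cmod (c n)) H).
- intros n. unfold coef_derive. rewrite Cmod_mult, Cmod_R, (Rabs_pos_eq (INR _)) by apply pos_INR.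
  lra.
Qed.

Lemma disc_summable_Cmult (c : nat -> C) (h : C) :
  disc_summable (fun n => Cmod (c n)) -> disc_summable (fun n => Cmod (h * c n)%C).
Proof.
intros H. apply (disc_summable_le _ _ (Cmod h) H). intros n.
rewrite Cmod_mult, Rabs_mult, (Rabs_pos_eq (Cmod h)) by apply Cmod_ge_0. lra.
Qed.

Lemma Cmod_lt_1 (x y : R) : x ^ 2 + y ^ 2 < 1 -> Cmod (x, y) < 1.
Proof.
intros H. unfold Cmod; simpl fst; simpl snd. rewrite <- sqrt_1.
apply sqrt_lt_1_alt. split; [|exact H]. apply Rplus_le_le_0_compat; apply pow2_ge_0.
Qed.

Lemma ex_re_series (c : nat -> C) (z : C) :
  disc_summable (fun n => Cmod (c n)) -> Cmod z < 1 ->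
  ex_series (fun n => fst (z ^ n * c n)%C).
Proof.
intros H Hz.
apply (ex_series_le (V := R_CompleteNormedModule) _ (fun n => Rabs (Cmod (c n) * Cmod z ^ n))).
- intros n. eapply Rle_trans; [apply re_le_Cmod|].
  rewrite Cmod_mult, Cmod_pow, Rmult_comm. apply Rle_abs.
- apply (disc_summable_abs _ _ H). rewrite Rabs_pos_eq; [exact Hz|apply Cmod_ge_0].
Qed.

Lemma is_series_re_series (c : nat -> C) (x y : R) :
  disc_summable (fun n => Cmod (c n)) -> x ^ 2 + y ^ 2 < 1 ->
  is_series (fun n => fst ((x, y) ^ n * c n)%C) (re_series c x y).
Proof.
intros H Hxy. apply Series_correct, ex_re_series; [exact H|now apply Cmod_lt_1].
Qed.

(** [K] is the second derivative at [rho] of the series of moduli. The linear part is Re (f'(z) h),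
    whose coefficient in Im h is Re (i f'(z)). *)
Lemma re_series_remainder (c : nat -> C) (rho : R) :
  disc_summable (fun n => Cmod (c n)) -> 0 <= rho < 1 ->
  exists K, 0 <= K /\ forall z w : C, Cmod z <= rho -> Cmod w <= rho ->
  Rabs (re_series c (fst w) (snd w) - re_series c (fst z) (snd z)
    - (re_series (coef_derive c) (fst z) (snd z) * fst (w - z)%C
       + re_series (fun n => Ci * coef_derive c n)%C (fst z) (snd z) * snd (w - z)%C))
  <= K * Cmod (w - z) ^ 2.
Proof.
intros H Hrho.
pose proof (disc_summable_derive _ (disc_summable_derive _ H)) as H2.
pose proof (disc_summable_abs _ rho H2) as H3. rewrite Rabs_pos_eq in H3 by lra.
specialize (H3 (proj2 Hrho)). cbv beta in H3.
set (d := fun n => Rabs (INR (S n) * (INR (S (S n)) * Cmod (c (S (S n)))) * rho ^ n)) in *.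
exists (Series d). split.
{ rewrite <- (Rmult_0_l (Series (fun _ => 0))), <- Series_scal_l.
  apply Series_le; [|exact H3]. intros n. split; [lra|]. rewrite Rmult_0_l. apply Rabs_pos. }
intros [x y] [x' y'] Hz Hw. simpl fst; simpl snd.
set (z := (x, y) : C) in *. set (w := (x', y') : C) in *. set (h := (w - z)%C).
assert (Ez : is_series (fun n => fst (z ^ n * c n)%C) (re_series c x y))
  by (apply Series_correct, ex_re_series; [exact H|lra]).
assert (Ew : is_series (fun n => fst (w ^ n * c n)%C) (re_series c x' y'))
  by (apply Series_correct, ex_re_series; [exact H|lra]).
pose proof (disc_summable_coef_derive c H) as H1.
assert (E1 : is_series (fun n => fst (z ^ n * coef_derive c n)%C) (re_series (coef_derive c) x y))
  by (apply Series_correct, ex_re_series; [exact H1|lra]).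
assert (E2 : is_series (fun n => fst (z ^ n * (Ci * coef_derive c n))%C)
    (re_series (fun n => Ci * coef_derive c n)%C x y))
  by (apply Series_correct, (ex_re_series (fun n => Ci * coef_derive c n)%C);
      [now apply (disc_summable_Cmult (coef_derive c))|lra]).
set (D := re_series (coef_derive c) x y * (x' + - x) + re_series (fun n => Ci * coef_derive c n)%C x y * (y' + - y)).
assert (ED : is_series (fun n => fst (Cnderiv z n * h * c n)%C) D).
{ apply is_series_decr_1.
  change (Cnderiv z 0) with (RtoC 0).
  match goal with |- is_series _ ?l => replace l with D
    by (unfold plus, opp; simpl; eqR; ring) end.
  apply (is_series_scal_r (x' + - x)) in E1. apply (is_series_scal_r (y' + - y)) in E2.
  eapply is_series_ext; [|exact (is_series_plus _ _ _ _ E1 E2)].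
  intros n. unfold coef_derive, Cnderiv, h, z, w. generalize (Cpow (x, y) n) (c (S n)) (INR (S n)).
  intros p q m. unfold plus, scal; simpl; unfold mult; simpl. eqR. ring. }
pose proof (is_series_minus _ _ _ _ (is_series_minus _ _ _ _ Ew Ez) ED) as ER.
(* The remainders of z^0 and z^1 vanish, so the series may start at exponent 2. *)
assert (E0 : is_series (fun n => fst ((w ^ S (S n) - z ^ S (S n) - Cnderiv z (S (S n)) * h) * c (S (S n)))%C)
  (re_series c x' y' - re_series c x y - D)).
{ apply is_series_incr_1 with (a := fun n => fst ((w ^ S n - z ^ S n - Cnderiv z (S n) * h) * c (S n))%C).
  apply is_series_incr_1 with (a := fun n => fst ((w ^ n - z ^ n - Cnderiv z n * h) * c n)%C).
  match type of ER with is_series _ ?l =>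
    match goal with |- is_series _ ?l' => replace l' with l end end.
  - eapply is_series_ext; [|exact ER]. intros n. unfold minus, plus, opp; simpl.
    eqR. ring.
  - unfold Cnderiv, h, minus, plus, opp; simpl. eqR. ring. }
rewrite <- (is_series_unique _ _ E0).
assert (B : forall n, Rabs (fst ((w ^ S (S n) - z ^ S (S n) - Cnderiv z (S (S n)) * h) * c (S (S n)))%C)
  <= Cmod h ^ 2 * d n).
{ intros n. eapply Rle_trans; [apply re_le_Cmod|]. rewrite Cmod_mult.
  pose proof (Cpow_taylor_remainder z w rho n Hz Hw) as T. fold h in T.
  eapply Rle_trans; [apply Rmult_le_compat_r; [apply Cmod_ge_0|exact T]|].
  unfold d. rewrite Rabs_pos_eq; [right; ring|].
  repeat apply Rmult_le_pos; try apply pos_INR; try apply Cmod_ge_0. apply pow_le; lra. }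
eapply Rle_trans; [apply Series_Rabs|].
- apply (ex_series_le (V := R_CompleteNormedModule) _ (fun n => Cmod h ^ 2 * d n)).
  + intros n. change (norm ?a) with (Rabs a). rewrite Rabs_Rabsolu. apply B.
  + now apply (ex_series_scal (V := R_NormedModule) (Cmod h ^ 2)).
- rewrite Rmult_comm, <- Series_scal_l. apply Series_le.
  + intros n. split; [apply Rabs_pos|apply B].
  + now apply (ex_series_scal (V := R_NormedModule) (Cmod h ^ 2)).
Qed.

Lemma differentiable_re_series (c : nat -> C) (x y : R) :
  disc_summable (fun n => Cmod (c n)) -> x ^ 2 + y ^ 2 < 1 ->
  differentiable_pt_lim (re_series c) x y (re_series (coef_derive c) x y)
    (re_series (fun n => Ci * coef_derive c n)%C x y).
Proof.
intros H Hxy e. pose proof (Cmod_lt_1 x y Hxy) as Hz.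
pose proof (Cmod_ge_0 (x, y)) as Pz.
set (rho := (1 + Cmod (x, y)) / 2).
destruct (re_series_remainder c rho H) as (K & HK & HR); [unfold rho; lra|].
(* The first bound keeps [(x', y')] within modulus [rho], as sqrt 2 m <= 2 m; the second gives 2 K
   m^2 <= e m. *)
set (d := Rmin ((1 - Cmod (x, y)) / 4) (e / (2 * (K + 1)))).
assert (Hd : 0 < d).
{ apply Rmin_pos; [lra|]. apply Rdiv_lt_0_compat; [apply cond_pos|lra]. }
exists (mkposreal d Hd). intros x' y' Hx Hy. simpl in Hx, Hy.
set (m := Rmax (Rabs (x' - x)) (Rabs (y' - y))).
assert (Hm : m < d) by now apply Rmax_lub_lt.
assert (Pm : 0 <= m) by (eapply Rle_trans; [apply Rabs_pos|apply Rmax_l]).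
assert (Hh : Cmod ((x', y') - (x, y))%C <= sqrt 2 * m) by apply (Cmod_2Rmax ((x', y') - (x, y))%C).
assert (S2 : sqrt 2 < 2).
{ rewrite <- (sqrt_square 2) at 2 by lra. apply sqrt_lt_1_alt. lra. }
assert (Hh2 : Cmod ((x', y') - (x, y))%C ^ 2 <= 2 * m ^ 2).
{ replace (2 * m ^ 2) with ((sqrt 2 * m) ^ 2).
  - apply pow_incr. split; [apply Cmod_ge_0|exact Hh].
  - rewrite Rpow_mult_distr, pow2_sqrt; lra. }
specialize (HR (x, y) (x', y')). simpl fst in HR; simpl snd in HR.
eapply Rle_trans; [apply HR|].
- unfold rho; lra.
- replace ((x', y') : C) with ((x, y) + ((x', y') - (x, y)))%C by ring.
  eapply Rle_trans; [apply Cmod_triangle|].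
  assert (m < (1 - Cmod (x, y)) / 4) by (eapply Rlt_le_trans; [exact Hm|apply Rmin_l]).
  assert (sqrt 2 * m <= 2 * m) by (apply Rmult_le_compat_r; lra).
  unfold rho. lra.
- assert (Hme : m < e / (2 * (K + 1))) by (eapply Rlt_le_trans; [exact Hm|apply Rmin_r]).
  apply Rlt_div_r in Hme; [|lra].
  assert (K * Cmod ((x', y') - (x, y))%C ^ 2 <= K * (2 * m ^ 2)) by now apply Rmult_le_compat_l.
  fold m.
  assert (m * (m * (2 * (K + 1))) <= m * e) by (apply Rmult_le_compat_l; lra).
  pose proof (pow2_ge_0 m). simpl in *. lra.
Qed.

(** * Inner product and slice actions on the octonions *)

(** A named constructor in place of a nested pair, so that the linear operations can be evaluated by
    rewriting. *)
Definition oct (a b c d e f g h : R) : Oct := ((((a, b), (c, d)), ((e, f), (g, h))) : Quat * Quat).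

Lemma oct_plus (a b c d e f g h a' b' c' d' e' f' g' h' : R) :
  plus (oct a b c d e f g h) (oct a' b' c' d' e' f' g' h') =
  oct (a + a') (b + b') (c + c') (d + d') (e + e') (f + f') (g + g') (h + h').
Proof. reflexivity. Qed.

Lemma oct_scal (r a b c d e f g h : R) :
  scal r (oct a b c d e f g h) =
  oct (r * a) (r * b) (r * c) (r * d) (r * e) (r * f) (r * g) (r * h).
Proof. reflexivity. Qed.

Lemma oct_opp (a b c d e f g h : R) :
  opp (oct a b c d e f g h) = oct (- a) (- b) (- c) (- d) (- e) (- f) (- g) (- h).
Proof. reflexivity. Qed.

Definition ip (p q : Oct) : R :=
  let '(((a, b), (c, d)), ((e, f), (g, h))) := (p : Quat * Quat) in
  let '(((a', b'), (c', d')), ((e', f'), (g', h'))) := (q : Quat * Quat) in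
  a * a' + b * b' + c * c' + d * d' + e * e' + f * f' + g * g' + h * h'.

Lemma oct_ind (P : Oct -> Prop) :
  (forall a b c d e f g h, P (oct a b c d e f g h)) -> forall p, P p.
Proof. intros H [[[a b] [c d]] [[e f] [g h]]]. apply H. Qed.

Ltac octs := repeat match goal with p : NormedModule.sort R_AbsRing Oct_NM |- _ =>
  revert p; apply oct_ind; intros end.

(* [plus], [scal] and [opp] reduce only on explicit 8-tuples, so products and
   linear operations are evaluated in turn. *)
Ltac oct_ring := unfold slice_pt, Oim, minus; unfold Ozero, Oone; unfold Oreal, Ore;
  do 4 (
    repeat match goal with |- context [(((?a, ?b), (?c, ?d)), ((?e, ?f), (?g, ?h)))] =>
      change (((a, b), (c, d)), ((e, f), (g, h))) with (oct a b c d e f g h) end;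
    repeat first [rewrite oct_plus | rewrite oct_scal | rewrite oct_opp];
    cbv [oct ip Omult Qplus Qopp Qmult Qconj Cminus Cplus Copp Cmult Cconj fst snd]);
  try match goal with |- @eq _ (?a, ?b) ?c => change (@eq (Quat * Quat) (a, b) c) end;
  repeat match goal with |- (_, _) = (_, _) => apply f_equal2 end; eqR; ring.

Lemma ip_comm (p q : Oct) : ip p q = ip q p.
Proof. octs. oct_ring. Qed.

Lemma ip_plus_l (p q r : Oct) : ip (plus p q) r = ip p r + ip q r.
Proof. octs. oct_ring. Qed.

Lemma ip_opp_l (p r : Oct) : ip (opp p) r = - ip p r.
Proof. octs. oct_ring. Qed.

Lemma ip_scal_l (k : R) (p r : Oct) : ip (scal k p) r = k * ip p r.
Proof. octs. oct_ring. Qed.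

Lemma ip_minus_l (p q r : Oct) : ip (minus p q) r = ip p r - ip q r.
Proof. unfold minus. rewrite ip_plus_l, ip_opp_l. ring. Qed.

Lemma ip_plus_r (p q r : Oct) : ip r (plus p q) = ip r p + ip r q.
Proof. rewrite !(ip_comm r). apply ip_plus_l. Qed.

Lemma ip_scal_r (k : R) (p r : Oct) : ip r (scal k p) = k * ip r p.
Proof. rewrite !(ip_comm r). apply ip_scal_l. Qed.

Lemma ip_self (p : Oct) : ip p p = norm p ^ 2.
Proof.
revert p. apply oct_ind. intros. unfold oct. rewrite norm_Oct, pow2_sqrt.
- simpl. ring.
- repeat apply Rplus_le_le_0_compat; apply pow2_ge_0.
Qed.

Lemma norm_Oct_eq0 (p : Oct) : norm p = 0 -> p = Ozero.
Proof. exact (norm_eq_zero (V := Oct_NM) p). Qed.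

(** The device by which octonion identities are reduced to real ones: pair with an arbitrary [r],
    move everything onto [r], and use [ring]. *)
Lemma ip_ext (p q : Oct) : (forall r, ip p r = ip q r) -> p = q.
Proof.
intros H. assert (E : minus p q = Ozero).
{ apply norm_Oct_eq0. apply Rsqr_0_uniq. rewrite Rsqr_pow2, <- ip_self, ip_minus_l, H. ring. }
transitivity (plus (minus p q) q); [|rewrite E]; clear; octs; oct_ring.
Qed.

Lemma ip_zero_l (p : Oct) : ip Ozero p = 0.
Proof. octs. unfold Ozero, Oreal. cbv [oct ip]. ring. Qed.

Lemma ip_le_norm (p q : Oct) : ip p q <= norm p * norm q.
Proof.
destruct (Req_dec (norm q) 0) as [E|Nq].
- apply norm_Oct_eq0 in E as ->. rewrite ip_comm.
  rewrite ip_zero_l.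
  apply Rmult_le_pos; apply norm_ge_0.
- assert (Pq : 0 < norm q) by (pose proof (norm_ge_0 q); lra).
  (* Expanded, this square is 2 |p| |q| (|p| |q| - <p, q>). *)
  assert (H : 0 <= ip (minus (scal (norm q) p) (scal (norm p) q)) (minus (scal (norm q) p) (scal (norm p) q)))
    by (rewrite ip_self; apply pow2_ge_0).
  rewrite ip_minus_l, !(ip_comm _ (minus _ _)), !ip_minus_l, !ip_scal_l, !ip_scal_r,
    !ip_self, (ip_comm q p) in H.
  destruct (Req_dec (norm p) 0) as [E|Np].
  + apply norm_Oct_eq0 in E as ->. rewrite ip_zero_l.
    apply Rmult_le_pos; apply norm_ge_0.
  + assert (Pp : 0 < norm p) by (pose proof (norm_ge_0 p); lra).
    apply (Rmult_le_reg_l (2 * (norm p * norm q))).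
    { apply Rmult_lt_0_compat; [lra|now apply Rmult_lt_0_compat]. }
    lra.
Qed.

Lemma norm_ip_bound (p : Oct) (m : R) : 0 <= m -> ip p p <= m * norm p -> norm p <= m.
Proof.
intros Hm H. rewrite ip_self in H. pose proof (norm_ge_0 p).
destruct (Req_dec (norm p) 0) as [->|N]; [exact Hm|].
apply (Rmult_le_reg_r (norm p)); lra.
Qed.

Lemma abs_ip_le_norm (p q : Oct) : Rabs (ip p q) <= norm p * norm q.
Proof.
apply Rabs_le. split; [|apply ip_le_norm].
pose proof (ip_le_norm (opp p) q) as H. rewrite ip_opp_l, (norm_opp p) in H. lra.
Qed.

Lemma Omult_scal_r (k : R) (p q : Oct) : Omult p (scal k q) = scal k (Omult p q).
Proof. octs. oct_ring. Qed.

Lemma Omult_slice_pt (I q : Oct) (x y : R) :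
  Omult (slice_pt I x y) q = plus (scal x q) (scal y (Omult I q)).
Proof. octs. oct_ring. Qed.

(** Left alternativity, I (I q) = (I I) q, checked in coordinates for purely imaginary [I]. *)
Lemma imag_unit_square (I q : Oct) : imag_unit I -> Omult I (Omult I q) = opp q.
Proof.
intros HI. destruct (imag_unit_re_norm I HI) as [H0 H1].
assert (E : Omult I (Omult I q) = scal (- ip I I) q).
{ clear H1 HI. revert I H0. apply (oct_ind (fun I => _ -> _)). intros a b c d e f g h H0.
  change (a = 0) in H0. subst a. octs. oct_ring. }
rewrite E, ip_self, H1. clear. octs. oct_ring.
Qed.

(** Skewness of left multiplication: it makes the adjoint of [act I c] the action of the conjugate
    of [c], and so gives [norm_act]. *)
Lemma ip_imag_unit (I p q : Oct) : imag_unit I -> ip (Omult I p) q = - ip p (Omult I q).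
Proof.
intros HI. destruct (imag_unit_re_norm I HI) as [H0 _]. clear HI.
revert I H0. apply (oct_ind (fun I => _ -> _)). intros a b c d e f g h H0.
change (a = 0) in H0. subst a. octs. oct_ring.
Qed.

(** Left multiplication by [I] is a complex structure, by alternativity; [act I]
    is the resulting scalar multiplication by complex numbers. *)
Definition act (I : Oct) (c : C) (p : Oct) : Oct :=
  plus (scal (fst c) p) (scal (snd c) (Omult I p)).

Section Action.

Context (I : Oct) (HI : imag_unit I).

Lemma act_slice_pt (x y : R) (p : Oct) : Omult (slice_pt I x y) p = act I (x, y) p.
Proof. apply Omult_slice_pt. Qed.

Lemma ip_act (c : C) (p q : Oct) :
  ip (act I c p) q = fst c * ip p q - snd c * ip p (Omult I q).
Proof.
unfold act. rewrite ip_plus_l, !ip_scal_l, (ip_imag_unit I p q HI). ring.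
Qed.

Lemma ip_act_conj (c : C) (p q : Oct) : ip (act I c p) q = ip p (act I (Cconj c) q).
Proof.
rewrite ip_act. unfold act. rewrite ip_plus_r, !ip_scal_r. simpl. ring.
Qed.

Lemma act_mult (c c' : C) (p : Oct) : act I (c * c')%C p = act I c (act I c' p).
Proof.
apply ip_ext. intros r. rewrite !ip_act, (imag_unit_square I r HI), (ip_comm p (opp r)), ip_opp_l,
  (ip_comm r p). simpl. ring.
Qed.

Lemma act_1 (p : Oct) : act I 1 p = p.
Proof. apply ip_ext. intros r. rewrite ip_act. simpl. ring. Qed.

Lemma act_plus (c c' : C) (p : Oct) : act I (c + c')%C p = plus (act I c p) (act I c' p).
Proof. apply ip_ext. intros r. rewrite ip_plus_l, !ip_act. simpl. ring. Qed.

Lemma norm_act (c : C) (p : Oct) : norm (act I c p) = Cmod c * norm p.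
Proof.
assert (E : norm (act I c p) ^ 2 = (Cmod c * norm p) ^ 2).
{ rewrite <- ip_self, ip_act_conj, <- act_mult, ip_comm, ip_act.
  rewrite Rpow_mult_distr, <- ip_self. unfold Cmod. rewrite pow2_sqrt.
  - simpl. ring.
  - apply Rplus_le_le_0_compat; apply pow2_ge_0. }
rewrite <- !Rsqr_pow2 in E. apply Rsqr_inj in E; [exact E|apply norm_ge_0|].
apply Rmult_le_pos; [apply Cmod_ge_0|apply norm_ge_0].
Qed.

Lemma norm_Oone : norm Oone = 1.
Proof.
unfold Oone, Oreal. rewrite norm_Oct. rewrite <- sqrt_1 at 2. f_equal. ring.
Qed.

Lemma slice_pt_act (x y : R) : slice_pt I x y = act I (x, y) Oone.
Proof. rewrite <- act_slice_pt. clear HI. octs. oct_ring. Qed.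

Lemma unit_ball_slice_pt (x y : R) : unit_ball (slice_pt I x y) <-> x ^ 2 + y ^ 2 < 1.
Proof.
unfold unit_ball. rewrite slice_pt_act, norm_act, norm_Oone, Rmult_1_r.
split; [|apply Cmod_lt_1].
intros H. apply Rnot_le_lt. intros L. apply (Rlt_not_le _ _ H).
unfold Cmod. simpl fst; simpl snd. rewrite <- sqrt_1. now apply sqrt_le_1_alt.
Qed.

Lemma act_Opow (x y : R) (n : nat) (p : Oct) :
  Omult (Opow (slice_pt I x y) n) p = act I ((x, y) ^ n) p.
Proof.
assert (E : Opow (slice_pt I x y) n = act I ((x, y) ^ n) Oone).
{ induction n as [|n IH].
  - simpl. now rewrite act_1.
  - change (Opow (slice_pt I x y) (S n)) with (Omult (slice_pt I x y) (Opow (slice_pt I x y) n)).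
    now rewrite IH, act_slice_pt, Cpow_S, act_mult. }
rewrite E. destruct ((x, y) ^ n)%C as [u v]. rewrite <- slice_pt_act. apply act_slice_pt.
Qed.

End Action.

Lemma imag_unit_Oi : imag_unit Oi.
Proof. unfold imag_unit, Oi. change (opp Oone) with (opp (oct 1 0 0 0 0 0 0 0)).
  oct_ring. Qed.

(** The sign condition on [y] is what [exists_angle] requires, because [acos] yields angles with
    nonnegative sine. *)
Lemma slice_pt_surj (w : Oct) :
  exists (I : Oct) (x y : R), imag_unit I /\ 0 <= y /\ w = slice_pt I x y.
Proof.
assert (Ew : w = plus (Oreal (Ore w)) (Oim w)) by (octs; oct_ring).
destruct (Req_dec (norm (Oim w)) 0) as [E|N].
- exists Oi, (Ore w), 0. split; [apply imag_unit_Oi|]. split; [lra|].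
  apply norm_Oct_eq0 in E. rewrite Ew, E at 1. unfold slice_pt. f_equal.
  unfold Oi. oct_ring.
- exists (scal (/ norm (Oim w)) (Oim w)), (Ore w), (norm (Oim w)).
  split; [|split; [apply norm_ge_0|]].
  + unfold imag_unit.
    assert (E : forall k, Omult (scal k (Oim w)) (scal k (Oim w))
      = scal (- (k ^ 2 * ip (Oim w) (Oim w))) Oone) by (clear; intros; octs; oct_ring).
    rewrite E, ip_self.
    replace (- ((/ norm (Oim w)) ^ 2 * norm (Oim w) ^ 2)) with (- (1)) by (field; exact N).
    clear. oct_ring.
  + unfold slice_pt. rewrite Ew at 1. f_equal. symmetry.
    rewrite (scal_assoc (norm (Oim w)) (/ norm (Oim w)) (Oim w)).
    change (mult (norm (Oim w)) (/ norm (Oim w))) with (norm (Oim w) * / norm (Oim w)).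
    rewrite Rinv_r by exact N. exact (scal_one (K := R_AbsRing) (Oim w)).
Qed.

Lemma act_transitive (p q : Oct) : p <> Ozero ->
  exists (I : Oct) (c : C), imag_unit I /\ q = act I c p.
Proof.
intros Hp.
assert (N : norm p <> 0) by (intros E; now apply Hp, norm_Oct_eq0).
(* This is q p^(-1): twice the real part of [p] minus [p] is its conjugate. That w p = q is right
   alternativity, in the form (q conj(p)) p = |p|^2 q. *)
set (w := scal (/ norm p ^ 2) (Omult q (minus (Oreal (2 * Ore p)) p))).
assert (Ew : Omult w p = q).
{ assert (E : Omult (Omult q (minus (Oreal (2 * Ore p)) p)) p = scal (ip p p) q)
    by (clear; octs; oct_ring).
  rewrite ip_self in E.
  transitivity (scal (/ norm p ^ 2) (Omult (Omult q (minus (Oreal (2 * Ore p)) p)) p)).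
  - unfold w. generalize (Omult q (minus (Oreal (2 * Ore p)) p)) (/ norm p ^ 2).
    clear. intros o k. octs. oct_ring.
  - rewrite E. generalize (norm p ^ 2) (pow_nonzero _ 2 N). clear. intros k Hk.
    octs. rewrite !oct_scal. unfold oct. repeat apply f_equal2; now field. }
destruct (slice_pt_surj w) as (I & x & y & HI & _ & E).
exists I, (x, y). split; [exact HI|]. now rewrite <- Ew, E, act_slice_pt.
Qed.

(** * Recovering octonion statements from inner products *)

Definition oct_of (phi : Oct -> R) : Oct :=
  oct (phi (oct 1 0 0 0 0 0 0 0)) (phi (oct 0 1 0 0 0 0 0 0))
      (phi (oct 0 0 1 0 0 0 0 0)) (phi (oct 0 0 0 1 0 0 0 0))
      (phi (oct 0 0 0 0 1 0 0 0)) (phi (oct 0 0 0 0 0 1 0 0))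
      (phi (oct 0 0 0 0 0 0 1 0)) (phi (oct 0 0 0 0 0 0 0 1)).

(** The same vector as [oct_of phi], but built with [plus] and [scal], through which derivatives,
    continuity and the triangle inequality propagate. *)
Definition basis_sum (phi : Oct -> R) : Oct :=
  plus (scal (phi (oct 1 0 0 0 0 0 0 0)) (oct 1 0 0 0 0 0 0 0))
  (plus (scal (phi (oct 0 1 0 0 0 0 0 0)) (oct 0 1 0 0 0 0 0 0))
  (plus (scal (phi (oct 0 0 1 0 0 0 0 0)) (oct 0 0 1 0 0 0 0 0))
  (plus (scal (phi (oct 0 0 0 1 0 0 0 0)) (oct 0 0 0 1 0 0 0 0))
  (plus (scal (phi (oct 0 0 0 0 1 0 0 0)) (oct 0 0 0 0 1 0 0 0))
  (plus (scal (phi (oct 0 0 0 0 0 1 0 0)) (oct 0 0 0 0 0 1 0 0))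
  (plus (scal (phi (oct 0 0 0 0 0 0 1 0)) (oct 0 0 0 0 0 0 1 0))
        (scal (phi (oct 0 0 0 0 0 0 0 1)) (oct 0 0 0 0 0 0 0 1)))))))).

Lemma basis_sum_ip (p : Oct) : basis_sum (ip p) = p.
Proof. unfold basis_sum. octs. oct_ring. Qed.

(** Riesz representation: it assembles an octonion from real numbers depending linearly on [p], such
    as Taylor coefficients or sums of series. *)
Lemma ip_oct_of (phi : Oct -> R) :
  (forall p q, phi (plus p q) = phi p + phi q) -> (forall k p, phi (scal k p) = k * phi p) ->
  forall p, ip (oct_of phi) p = phi p.
Proof.
intros H1 H2 p. rewrite <- (basis_sum_ip p) at 2. unfold basis_sum.
rewrite !H1, !H2. unfold oct_of.
generalize (phi (oct 1 0 0 0 0 0 0 0)) (phi (oct 0 1 0 0 0 0 0 0))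
      (phi (oct 0 0 1 0 0 0 0 0)) (phi (oct 0 0 0 1 0 0 0 0))
      (phi (oct 0 0 0 0 1 0 0 0)) (phi (oct 0 0 0 0 0 1 0 0))
      (phi (oct 0 0 0 0 0 0 1 0)) (phi (oct 0 0 0 0 0 0 0 1)).
clear. intros. octs. oct_ring.
Qed.

Lemma is_linear_ip (p : Oct) : is_linear (K := R_AbsRing) (U := Oct_NM) (V := R_NormedModule) (fun q => ip q p).
Proof.
split.
- intros q r. apply ip_plus_l.
- intros k q. apply ip_scal_l.
- exists (norm p + 1). split; [pose proof (norm_ge_0 p); lra|].
  intros q. change (Rabs (ip q p) <= (norm p + 1) * norm q).
  pose proof (abs_ip_le_norm q p). pose proof (norm_ge_0 q). lra.
Qed.

Lemma is_derive_ip (g : R -> Oct) (t : R) (l p : Oct) :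
  is_derive (K := R_AbsRing) (V := Oct_NM) g t l -> is_derive (fun s => ip (g s) p) t (ip l p).
Proof.
intros Hg. apply (filterdiff_ext_lin _ (fun y : R => ip (scal y l) p)).
- apply (filterdiff_comp' (V := Oct_NM) g (fun q => ip q p) t _ (fun q => ip q p) Hg).
  apply filterdiff_linear, is_linear_ip.
- intros y. apply ip_scal_l.
Qed.

(** One induction over the eight summands serves both for [D] meaning derivative and for [D] meaning
    continuity. *)
Lemma basis_sum_closed (T : Type) (D : (T -> Oct) -> Oct -> Prop) (phi : T -> Oct -> R)
    (l : Oct -> R) :
  (forall g h p q, D g p -> D h q -> D (fun s => plus (g s) (h s)) (plus p q)) ->
  (forall e, D (fun s => scal (phi s e) e) (scal (l e) e)) ->
  D (fun s => basis_sum (phi s)) (basis_sum l).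
Proof.
intros Hp He. unfold basis_sum.
do 7 (apply Hp; [apply He|]). apply He.
Qed.

Lemma is_derive_of_ip (g : R -> Oct) (t : R) (l : Oct) :
  (forall p, is_derive (fun s => ip (g s) p) t (ip l p)) ->
  is_derive (K := R_AbsRing) (V := Oct_NM) g t l.
Proof.
intros H. rewrite <- (basis_sum_ip l).
apply (is_derive_ext (fun s => basis_sum (ip (g s)))).
{ intros s. apply basis_sum_ip. }
apply (basis_sum_closed R (fun g l => is_derive (K := R_AbsRing) (V := Oct_NM) g t l)).
- intros. now apply (is_derive_plus (V := Oct_NM)).
- intros e. apply (is_derive_scal_l (V := Oct_NM) (fun s => ip (g s) e)), H.
Qed.

Lemma continuous_of_ip (T : UniformSpace) (g : T -> Oct) (t : T) :
  (forall p, continuous (fun s => ip (g s) p) t) -> continuous (U := Oct_NM) g t.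
Proof.
intros H. apply (continuous_ext (fun s => basis_sum (ip (g s)))).
{ intros s. apply basis_sum_ip. }
apply (basis_sum_closed T (fun g _ => continuous (U := Oct_NM) g t) (fun s => ip (g s)) (ip Ozero)).
- intros. now apply (continuous_plus (V := Oct_NM)).
- intros e. apply (continuous_scal_l (V := Oct_NM) (fun s => ip (g s) e)), H.
Qed.

Lemma continuous_ip (T : UniformSpace) (g : T -> Oct) (t : T) (p : Oct) :
  continuous (U := Oct_NM) g t -> continuous (fun s => ip (g s) p) t.
Proof.
intros H. apply (continuous_comp (V := Oct_NM) g (fun q => ip q p)); [exact H|].
apply (filterdiff_continuous (U := Oct_NM) (V := R_NormedModule) (fun q => ip q p)).
eexists. apply filterdiff_linear, is_linear_ip.
Qed.

Lemma is_derive_Oderive (g : R -> Oct) (t : R) (l : Oct) :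
  is_derive (K := R_AbsRing) (V := Oct_NM) g t l -> Oderive g t = l.
Proof.
intros H. apply ip_ext. intros p.
rewrite <- (is_derive_unique _ _ _ (is_derive_ip g t l p H)). symmetry.
apply is_derive_unique, is_derive_ip, Oderive_correct. now exists l.
Qed.

Lemma locally_disc (x y : R) :
  x ^ 2 + y ^ 2 < 1 -> locally (x, y) (fun z : R * R => fst z ^ 2 + snd z ^ 2 < 1).
Proof.
intros H.
assert (C : continuous (fun z : R * R => fst z ^ 2 + snd z ^ 2) (x, y)).
{ assert (Sq : forall t, continuous (fun t : R => t ^ 2) t).
  { intros t. apply (ex_derive_continuous (V := R_NormedModule)). auto_derive; trivial. }
  apply (continuous_plus (V := R_NormedModule) (fun z : R * R => fst z ^ 2) (fun z => snd z ^ 2)).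
  - apply (continuous_comp (fun z : R * R => fst z) (fun t => t ^ 2)); [apply continuous_fst|apply Sq].
  - apply (continuous_comp (fun z : R * R => snd z) (fun t => t ^ 2)); [apply continuous_snd|apply Sq]. }
apply (C (fun s => s < 1)). apply (open_lt 1). exact H.
Qed.

(** * Slice regular functions have power series *)

(** Convergence is weak, tested against each [p]. The coefficients are the same on every slice. *)
Definition oct_series (a : nat -> Oct) (g : Oct -> Oct) : Prop :=
  forall (I : Oct) (x y : R) (p : Oct), imag_unit I -> x ^ 2 + y ^ 2 < 1 ->
    is_series (fun n => ip (act I ((x, y) ^ n) (a n)) p) (ip (g (slice_pt I x y)) p).

(** The real axis lies in every slice, which is why these coefficients do not mention [I]. *)
Definition taylor_coef (f : Oct -> Oct) (n : nat) : Oct :=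
  oct_of (fun p => taylor (fun s => ip (f (Oreal s)) p) n).

Lemma slice_pt_0 (I : Oct) (s : R) : slice_pt I s 0 = Oreal s.
Proof. octs. oct_ring. Qed.

Lemma plus_eq_0_opp (p q : Oct) : plus p q = Ozero -> p = opp q.
Proof.
intros H. apply ip_ext. intros r. pose proof (f_equal (fun s => ip s r) H) as E.
cbv beta in E. rewrite ip_plus_l, ip_zero_l in E. rewrite ip_opp_l. lra.
Qed.

Lemma scal_half_eq_0 (p : Oct) : scal (1 / 2) p = Ozero -> p = Ozero.
Proof.
intros H. apply ip_ext. intros r. pose proof (f_equal (fun s => ip s r) H) as E.
cbv beta in E. rewrite ip_scal_l, ip_zero_l in E. rewrite ip_zero_l. lra.
Qed.

(** Pairing with [p] and with [Omult I p] gives the two parts of a C_I-linear functional, so the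
    slice equation becomes the Cauchy-Riemann equations. *)
Lemma slice_regular_holomorphic (f : Oct -> Oct) (I p : Oct) :
  slice_regular unit_ball f -> imag_unit I ->
  holomorphic_disc (fun x y => ip (f (slice_pt I x y)) p)
    (fun x y => ip (f (slice_pt I x y)) (Omult I p))
    (fun x y => ip (slice_dx f I x y) p) (fun x y => ip (slice_dy f I x y) p).
Proof.
intros Hf HI.
assert (D : forall q x y, x ^ 2 + y ^ 2 < 1 ->
  differentiable_pt_lim (fun x y => ip (f (slice_pt I x y)) q) x y
    (ip (slice_dx f I x y) q) (ip (slice_dy f I x y) q)).
{ intros q x y Hxy.
  destruct (Hf I HI x y (proj2 (unit_ball_slice_pt I HI x y) Hxy)) as (_ & DY & CX & _).
  (* Total differentiability follows from one partial derivative that exists nearby and is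
     continuous, and the other at the point itself. *)
  apply filterdiff_differentiable_pt_lim.
  apply (is_derive_filterdiff (fun x y => ip (f (slice_pt I x y)) q) x y
    (fun x y => ip (slice_dx f I x y) q) (ip (slice_dy f I x y) q)).
  - apply (filter_imp (fun z : R * R => fst z ^ 2 + snd z ^ 2 < 1)).
    + intros [s t] Hst. apply (is_derive_ip (fun s => f (slice_pt I s t))), Oderive_correct.
      exact (proj1 (Hf I HI s t (proj2 (unit_ball_slice_pt I HI s t) Hst))).
    + now apply locally_disc.
  - apply (is_derive_ip (fun t => f (slice_pt I x t))), Oderive_correct. apply DY.
  - apply (continuous_ip _ (fun z : R * R => slice_dx f I (fst z) (snd z))). apply CX. }
intros x y Hxy.
destruct (Hf I HI x y (proj2 (unit_ball_slice_pt I HI x y) Hxy)) as (_ & _ & C1 & C2 & CR).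
apply scal_half_eq_0, plus_eq_0_opp in CR.
assert (CR' : Omult I (slice_dx f I x y) = slice_dy f I x y).
{ rewrite CR. apply ip_ext. intros r.
  rewrite (ip_imag_unit I _ _ HI), ip_opp_l, (ip_imag_unit I _ _ HI), (imag_unit_square I r HI).
  rewrite (ip_comm _ (opp r)), ip_opp_l, (ip_comm r). ring. }
split; [now apply D|]. split; [|split].
- replace (- ip (slice_dy f I x y) p) with (ip (slice_dx f I x y) (Omult I p)).
  replace (ip (slice_dx f I x y) p) with (ip (slice_dy f I x y) (Omult I p)).
  + now apply D.
  + rewrite CR. rewrite ip_opp_l, (ip_imag_unit I _ _ HI). ring.
  + rewrite <- CR', (ip_imag_unit I _ _ HI). ring.
- apply continuity_2d_pt_filterlim.
  exact (continuous_ip _ (fun z : R * R => slice_dx f I (fst z) (snd z)) (x, y) p C1).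
- apply continuity_2d_pt_filterlim.
  exact (continuous_ip _ (fun z : R * R => slice_dy f I (fst z) (snd z)) (x, y) p C2).
Qed.

Lemma slice_regular_real_series (f : Oct -> Oct) (p : Oct) (x : R) :
  slice_regular unit_ball f -> Rabs x < 1 ->
  is_series (fun n => taylor (fun s => ip (f (Oreal s)) p) n * x ^ n) (ip (f (Oreal x)) p).
Proof.
intros Hf Hx.
assert (Hx2 : x ^ 2 + 0 ^ 2 < 1).
{ rewrite <- (Rabs_R1) in Hx. apply Rsqr_lt_abs_1 in Hx. unfold Rsqr in Hx. simpl. lra. }
pose proof (holomorphic_series _ _ _ _ x 0
  (slice_regular_holomorphic f Oi p Hf imag_unit_Oi) Hx2) as S.
cbv beta in S. rewrite slice_pt_0 in S.
eapply is_series_ext; [|exact S]. intros n. cbv beta.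
change (@pair R R x (IZR Z0)) with (RtoC x). rewrite <- RtoC_pow.
unfold taylor. rewrite (Derive_n_ext _ (fun s => ip (f (Oreal s)) p))
  by (intros; now rewrite slice_pt_0).
simpl. eqR. ring.
Qed.

(** [oct_of] represents only linear functionals. Linearity in [p] is obtained from uniqueness of
    power series coefficients, not from rules for iterated derivatives. *)
Lemma ip_taylor_coef (f : Oct -> Oct) (n : nat) (p : Oct) :
  slice_regular unit_ball f ->
  ip (taylor_coef f n) p = taylor (fun s => ip (f (Oreal s)) p) n.
Proof.
intros Hf. unfold taylor_coef.
apply (ip_oct_of (fun p => taylor (fun s => ip (f (Oreal s)) p) n)); clear p.
- intros p q. apply (taylor_unique (fun n => taylor (fun s => ip (f (Oreal s)) p) n
    + taylor (fun s => ip (f (Oreal s)) q) n) _ 1); [lra|].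
  intros x Hx. rewrite ip_plus_r.
  eapply is_series_ext; [|exact (is_series_plus _ _ _ _
    (slice_regular_real_series f p x Hf Hx) (slice_regular_real_series f q x Hf Hx))].
  intros m. unfold plus; simpl. eqR. ring.
- intros k p. apply (taylor_unique (fun n => k * taylor (fun s => ip (f (Oreal s)) p) n) _ 1); [lra|].
  intros x Hx. rewrite ip_scal_r.
  eapply is_series_ext; [|exact (is_series_scal_l k _ _
    (slice_regular_real_series f p x Hf Hx))].
  intros m. cbv beta. change (scal ?a ?b) with (a * b). eqR. ring.
Qed.

Lemma slice_regular_series (f : Oct -> Oct) :
  slice_regular unit_ball f -> oct_series (taylor_coef f) f.
Proof.
intros Hf I x y p HI Hxy.
eapply is_series_ext; [|exact (holomorphic_series _ _ _ _ x y
  (slice_regular_holomorphic f I p Hf HI) Hxy)].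
intros n. cbv beta. rewrite (ip_act I HI), !(ip_taylor_coef f n _ Hf).
unfold taylor. now rewrite !(Derive_n_ext (fun s => ip (f (slice_pt I s 0)) _)
  (fun s => ip (f (Oreal s)) _)) by (intros; now rewrite slice_pt_0).
Qed.

Lemma norm_le_sum_ip (p : Oct) (phi : Oct -> R) : p = basis_sum phi ->
  norm p <= Rabs (phi (oct 1 0 0 0 0 0 0 0)) + (Rabs (phi (oct 0 1 0 0 0 0 0 0))
    + (Rabs (phi (oct 0 0 1 0 0 0 0 0)) + (Rabs (phi (oct 0 0 0 1 0 0 0 0))
    + (Rabs (phi (oct 0 0 0 0 1 0 0 0)) + (Rabs (phi (oct 0 0 0 0 0 1 0 0))
    + (Rabs (phi (oct 0 0 0 0 0 0 1 0)) + Rabs (phi (oct 0 0 0 0 0 0 0 1)))))))).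
Proof.
intros ->.
assert (T : forall a b : Oct, norm (plus a b) <= norm a + norm b)
  by apply (norm_triangle (V := Oct_NM)).
unfold basis_sum.
do 7 (eapply Rle_trans; [apply T|]; apply Rplus_le_compat;
  [rewrite norm_Oscal; unfold oct; rewrite norm_Oct; right;
   match goal with |- _ * sqrt ?s = _ => replace s with 1 by ring end;
   rewrite sqrt_1; ring|]).
rewrite norm_Oscal; unfold oct; rewrite norm_Oct; right.
match goal with |- _ * sqrt ?s = _ => replace s with 1 by ring end.
rewrite sqrt_1; ring.
Qed.

(** Each coordinate series converges on (-1, 1), so its radius is at least 1, and eight coordinates
    dominate the norm. *)
Lemma taylor_coef_summable (f : Oct -> Oct) :
  slice_regular unit_ball f -> disc_summable (fun n => norm (taylor_coef f n)).
Proof.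
intros Hf.
assert (H : forall p, disc_summable (fun n => Rabs (ip (taylor_coef f n) p))).
{ intros p. apply (disc_summable_le (fun n => ip (taylor_coef f n) p) _ 1).
  - apply disc_summable_intro. intros x Hx. apply ex_series_lim_0. eexists.
    eapply is_series_ext; [|apply (slice_regular_real_series f p x Hf)].
    + intros n. cbv beta. now rewrite ip_taylor_coef.
    + rewrite Rabs_pos_eq; lra.
  - intros n. rewrite Rabs_Rabsolu. lra. }
eapply (disc_summable_le (fun n =>
  Rabs (ip (taylor_coef f n) (oct 1 0 0 0 0 0 0 0)) + (Rabs (ip (taylor_coef f n) (oct 0 1 0 0 0 0 0 0))
    + (Rabs (ip (taylor_coef f n) (oct 0 0 1 0 0 0 0 0)) + (Rabs (ip (taylor_coef f n) (oct 0 0 0 1 0 0 0 0))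
    + (Rabs (ip (taylor_coef f n) (oct 0 0 0 0 1 0 0 0)) + (Rabs (ip (taylor_coef f n) (oct 0 0 0 0 0 1 0 0))
    + (Rabs (ip (taylor_coef f n) (oct 0 0 0 0 0 0 1 0)) + Rabs (ip (taylor_coef f n) (oct 0 0 0 0 0 0 0 1))))))))) _ 1).
- repeat (apply disc_summable_plus; [apply H|]). apply H.
- intros n. rewrite Rmult_1_l, (Rabs_pos_eq (norm _)) by apply norm_ge_0.
  eapply Rle_trans; [|apply Rle_abs]. apply norm_le_sum_ip. symmetry. apply basis_sum_ip.
Qed.

(** * Slice derivatives of octonion power series *)

Definition coords (a : nat -> Oct) (I p : Oct) (n : nat) : C := (ip (a n) p, ip (a n) (Omult I p)).

(** The sum as an actual octonion, assembled from the scalar series; its differentiability is then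
    inherited from [re_series]. *)
Definition oct_sum (a : nat -> Oct) (I : Oct) (x y : R) : Oct :=
  oct_of (fun p => re_series (coords a I p) x y).

Definition coef_deriv (a : nat -> Oct) (n : nat) : Oct := scal (INR (S n)) (a (S n)).

Lemma coords_summable (a : nat -> Oct) (I p : Oct) :
  imag_unit I -> disc_summable (fun n => norm (a n)) ->
  disc_summable (fun n => Cmod (coords a I p n)).
Proof.
intros HI Ha. apply (disc_summable_le _ _ (sqrt 2 * norm p) Ha). intros n.
rewrite !Rabs_pos_eq by (apply Cmod_ge_0 || apply norm_ge_0).
eapply Rle_trans; [apply Cmod_2Rmax|]. rewrite Rmult_assoc.
apply Rmult_le_compat_l; [apply sqrt_pos|]. rewrite (Rmult_comm (norm p)).
unfold coords; simpl fst; simpl snd. apply Rmax_lub; [apply abs_ip_le_norm|].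
eapply Rle_trans; [apply abs_ip_le_norm|]. rewrite norm_Omult.
destruct (imag_unit_re_norm I HI) as [_ ->]. rewrite Rmult_1_l. lra.
Qed.

Lemma fst_mult_coords (a : nat -> Oct) (I p : Oct) (z : C) (n : nat) :
  imag_unit I -> fst (z * coords a I p n)%C = ip (act I z (a n)) p.
Proof. intros HI. rewrite (ip_act I HI). reflexivity. Qed.

Section OctSum.

Context (a : nat -> Oct) (I : Oct).
Hypothesis (Ha : disc_summable (fun n => norm (a n))) (HI : imag_unit I).

Lemma is_series_coords (p : Oct) (x y : R) : x ^ 2 + y ^ 2 < 1 ->
  is_series (fun n => ip (act I ((x, y) ^ n) (a n)) p) (re_series (coords a I p) x y).
Proof.
intros Hxy. eapply is_series_ext; [|apply (is_series_re_series _ x y (coords_summable a I p HI Ha) Hxy)].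
intros n. cbv beta. apply (fst_mult_coords a I p ((x, y) ^ n) n HI).
Qed.

Lemma ip_oct_sum (p : Oct) (x y : R) : x ^ 2 + y ^ 2 < 1 ->
  ip (oct_sum a I x y) p = re_series (coords a I p) x y.
Proof.
intros Hxy. unfold oct_sum.
apply (ip_oct_of (fun p => re_series (coords a I p) x y)); clear p.
- intros p q. apply is_series_unique.
  eapply is_series_ext; [|exact (is_series_plus _ _ _ _ (is_series_coords p x y Hxy) (is_series_coords q x y Hxy))].
  intros n. cbv beta. rewrite (fst_mult_coords a I (plus p q) ((x, y) ^ n) n HI), ip_plus_r. reflexivity.
- intros k p. apply is_series_unique.
  eapply is_series_ext; [|exact (is_series_scal_l k _ _ (is_series_coords p x y Hxy))].
  intros n. cbv beta. rewrite (fst_mult_coords a I (scal k p) ((x, y) ^ n) n HI), ip_scal_r. reflexivity.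
Qed.

End OctSum.

Lemma coef_deriv_summable (a : nat -> Oct) :
  disc_summable (fun n => norm (a n)) -> disc_summable (fun n => norm (coef_deriv a n)).
Proof.
intros H. apply (disc_summable_le (fun n => INR (S n) * norm (a (S n))) _ 1).
- exact (disc_summable_derive (fun n => norm (a n)) H).
- intros n. unfold coef_deriv. rewrite norm_Oscal, (Rabs_pos_eq (INR _)) by apply pos_INR. lra.
Qed.

Lemma coef_derive_coords (a : nat -> Oct) (I p : Oct) (n : nat) :
  coef_derive (coords a I p) n = coords (coef_deriv a) I p n.
Proof.
unfold coef_derive, coords, coef_deriv. rewrite !ip_scal_l.
apply injective_projections; simpl; ring.
Qed.

Lemma re_series_ext (c c' : nat -> C) (x y : R) :
  (forall n, c n = c' n) -> re_series c x y = re_series c' x y.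
Proof. intros H. apply Series_ext. intros n. now rewrite H. Qed.

Lemma oct_sum_differentiable (a : nat -> Oct) (I p : Oct) (x y : R) :
  disc_summable (fun n => norm (a n)) -> imag_unit I -> x ^ 2 + y ^ 2 < 1 ->
  differentiable_pt_lim (fun x y => ip (oct_sum a I x y) p) x y
    (ip (oct_sum (coef_deriv a) I x y) p)
    (ip (Omult I (oct_sum (coef_deriv a) I x y)) p).
Proof.
intros Ha HI Hxy. pose proof (coef_deriv_summable a Ha) as Hb.
pose proof (differentiable_re_series (coords a I p) x y (coords_summable a I p HI Ha) Hxy) as D.
rewrite (re_series_ext (coef_derive (coords a I p)) (coords (coef_deriv a) I p)) in D
  by apply coef_derive_coords.
rewrite <- (ip_oct_sum (coef_deriv a) I Hb HI p x y Hxy) in D.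
assert (E : re_series (fun n => Ci * coef_derive (coords a I p) n)%C x y
  = ip (Omult I (oct_sum (coef_deriv a) I x y)) p).
{ rewrite (ip_imag_unit I _ _ HI), (ip_oct_sum (coef_deriv a) I Hb HI _ x y Hxy).
  unfold re_series. rewrite <- Series_opp. apply Series_ext. intros n.
  rewrite coef_derive_coords. unfold coords. rewrite (imag_unit_square I p HI).
  rewrite (ip_comm _ (opp p)), ip_opp_l, (ip_comm p). simpl. ring. }
rewrite E in D.
apply (differentiable_pt_lim_ext (re_series (coords a I p))); [|exact D].
apply locally_2d_locally.
apply (filter_imp (fun z : R * R => fst z ^ 2 + snd z ^ 2 < 1)); [|now apply locally_disc].
intros [s t] Hst. symmetry. exact (ip_oct_sum a I Ha HI p s t Hst).
Qed.

Lemma differentiable_pt_lim_partial (u : R -> R -> R) (x y lx ly : R) :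
  differentiable_pt_lim u x y lx ly ->
  is_derive (fun t => u t y) x lx /\ is_derive (fun t => u x t) y ly.
Proof.
intros H. split; apply is_derive_Reals.
- replace lx with (lx * 1 + ly * 0) by ring.
  apply (derivable_pt_lim_comp_2d u (fun t => t) (fun _ => y) x lx ly 1 0 H);
    [apply derivable_pt_lim_id|apply derivable_pt_lim_const].
- replace ly with (lx * 0 + ly * 1) by ring.
  apply (derivable_pt_lim_comp_2d u (fun _ => x) (fun t => t) y lx ly 0 1 H);
    [apply derivable_pt_lim_const|apply derivable_pt_lim_id].
Qed.

Section SeriesDerivative.

Context (a : nat -> Oct) (g : Oct -> Oct).
Hypothesis (Ha : disc_summable (fun n => norm (a n))) (Hg : oct_series a g).

Lemma oct_seriesE (I : Oct) (x y : R) : imag_unit I -> x ^ 2 + y ^ 2 < 1 ->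
  g (slice_pt I x y) = oct_sum a I x y.
Proof.
intros HI Hxy. apply ip_ext. intros p.
rewrite (ip_oct_sum a I Ha HI p x y Hxy).
transitivity (Series (fun n => ip (act I ((x, y) ^ n) (a n)) p)).
- symmetry. exact (is_series_unique _ _ (Hg I x y p HI Hxy)).
- exact (is_series_unique _ _ (is_series_coords a I Ha HI p x y Hxy)).
Qed.

Lemma oct_series_partial (I : Oct) (x y : R) : imag_unit I -> x ^ 2 + y ^ 2 < 1 ->
  is_derive (K := R_AbsRing) (V := Oct_NM) (fun t => g (slice_pt I t y)) x
    (oct_sum (coef_deriv a) I x y) /\
  is_derive (K := R_AbsRing) (V := Oct_NM) (fun t => g (slice_pt I x t)) y
    (Omult I (oct_sum (coef_deriv a) I x y)).
Proof.
intros HI Hxy.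
assert (D : forall p, differentiable_pt_lim (fun x y => ip (g (slice_pt I x y)) p) x y
    (ip (oct_sum (coef_deriv a) I x y) p)
    (ip (Omult I (oct_sum (coef_deriv a) I x y)) p)).
{ intros p. apply (differentiable_pt_lim_ext (fun x y => ip (oct_sum a I x y) p));
    [|exact (oct_sum_differentiable a I p x y Ha HI Hxy)].
  apply locally_2d_locally.
  apply (filter_imp (fun z : R * R => fst z ^ 2 + snd z ^ 2 < 1)); [|now apply locally_disc].
  intros [s t] Hst. exact (f_equal (fun o => ip o p) (eq_sym (oct_seriesE I s t HI Hst))). }
split; apply is_derive_of_ip; intros p.
- exact (proj1 (differentiable_pt_lim_partial _ x y _ _ (D p))).
- exact (proj2 (differentiable_pt_lim_partial _ x y _ _ (D p))).
Qed.

Lemma oct_series_slice_dx (I : Oct) (x y : R) : imag_unit I -> x ^ 2 + y ^ 2 < 1 ->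
  slice_dx g I x y = oct_sum (coef_deriv a) I x y.
Proof. intros HI Hxy. exact (is_derive_Oderive _ _ _ (proj1 (oct_series_partial I x y HI Hxy))). Qed.

Lemma oct_series_slice_dy (I : Oct) (x y : R) : imag_unit I -> x ^ 2 + y ^ 2 < 1 ->
  slice_dy g I x y = Omult I (oct_sum (coef_deriv a) I x y).
Proof. intros HI Hxy. exact (is_derive_Oderive _ _ _ (proj2 (oct_series_partial I x y HI Hxy))). Qed.

(** Used at each iteration of the slice derivative: [slice_derivE], which frees [slice_deriv] from
    its choice of unit, asks for slice regularity. *)
Lemma oct_series_regular : slice_regular unit_ball g.
Proof.
intros I HI x y HO. pose proof (proj1 (unit_ball_slice_pt I HI x y) HO) as Hxy.
destruct (oct_series_partial I x y HI Hxy) as [D1 D2].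
pose proof (coef_deriv_summable a Ha) as Hb.
assert (C : forall p, continuity_2d_pt (fun x y => ip (oct_sum (coef_deriv a) I x y) p) x y).
{ intros p. apply differentiable_continuity_pt.
  eexists. eexists. exact (oct_sum_differentiable (coef_deriv a) I p x y Hb HI Hxy). }
pose proof (locally_disc x y Hxy) as L.
split; [eexists; exact D1|]. split; [eexists; exact D2|]. split; [|split].
- apply continuous_of_ip. intros p.
  apply (continuous_ext_loc _ (fun z : R * R => ip (oct_sum (coef_deriv a) I (fst z) (snd z)) p)).
  + apply (filter_imp (fun z : R * R => fst z ^ 2 + snd z ^ 2 < 1)); [|exact L].
    intros [s t] Hst. exact (f_equal (fun o => ip o p) (eq_sym (oct_series_slice_dx I s t HI Hst))).
  + exact (proj1 (continuity_2d_pt_filterlim _ _ _) (C p)).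
- apply continuous_of_ip. intros p.
  apply (continuous_ext_loc _ (fun z : R * R => - ip (oct_sum (coef_deriv a) I (fst z) (snd z)) (Omult I p))).
  + apply (filter_imp (fun z : R * R => fst z ^ 2 + snd z ^ 2 < 1)); [|exact L].
    intros [s t] Hst. simpl fst in *; simpl snd in *.
    rewrite (oct_series_slice_dy I s t HI Hst). symmetry. exact (ip_imag_unit I _ p HI).
  + apply (continuous_opp (V := R_NormedModule)
      (fun z : R * R => ip (oct_sum (coef_deriv a) I (fst z) (snd z)) (Omult I p))).
    exact (proj1 (continuity_2d_pt_filterlim _ _ _) (C (Omult I p))).
- rewrite (oct_series_slice_dx I x y HI Hxy), (oct_series_slice_dy I x y HI Hxy), (imag_unit_square I _ HI).
  apply ip_ext. intros p. rewrite ip_scal_l, ip_plus_l, ip_opp_l, ip_zero_l. ring.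
Qed.

Lemma oct_series_slice_deriv : oct_series (coef_deriv a) (slice_deriv g).
Proof.
intros I x y p HI Hxy.
rewrite (slice_derivE unit_ball g I x y oct_series_regular HI (proj2 (unit_ball_slice_pt I HI x y) Hxy)).
rewrite (oct_series_slice_dx I x y HI Hxy), (oct_series_slice_dy I x y HI Hxy), (imag_unit_square I _ HI).
rewrite ip_scal_l, ip_minus_l, ip_opp_l.
pose proof (coef_deriv_summable a Ha) as Hb.
rewrite (ip_oct_sum (coef_deriv a) I Hb HI p x y Hxy).
set (r := re_series _ x y). replace (1 / 2 * (r - - r)) with r by field.
exact (is_series_coords (coef_deriv a) I Hb HI p x y Hxy).
Qed.

End SeriesDerivative.

Lemma oct_series_0 (a : nat -> Oct) (g : Oct -> Oct) : oct_series a g -> g Ozero = a 0%nat.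
Proof.
intros H. apply ip_ext. intros p.
assert (S := H Oi 0 0 p imag_unit_Oi). rewrite slice_pt_0 in S.
specialize (S ltac:(lra)). change (Oreal 0) with Ozero in S.
rewrite <- (is_series_unique _ _ S).
set (b := fun n => ip (act Oi ((0, 0) ^ n) (a n)) p).
assert (B : is_series b (sum_n b 0)).
{ apply is_series_finite. intros [|n] Hn; [lia|]. unfold b.
  rewrite (ip_act Oi imag_unit_Oi), Cpow_S. simpl. ring. }
rewrite sum_O in B. rewrite (is_series_unique _ _ B).
exact (f_equal (fun o => ip o p) (act_1 Oi imag_unit_Oi (a 0%nat))).
Qed.

(** Differentiation shifts the index, so the induction tracks all coefficients; [k = 0] is the case
    of interest. *)
Lemma slice_deriv_n_series (n : nat) (a : nat -> Oct) (f : Oct -> Oct) :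
  disc_summable (fun n => norm (a n)) -> oct_series a f ->
  exists b, disc_summable (fun n => norm (b n)) /\ oct_series b (slice_deriv_n n f) /\
    forall k, b k = scal (INR (fact (n + k)) / INR (fact k)) (a (n + k)%nat).
Proof.
intros Ha Hf. induction n as [|n IH].
- exists a. split; [exact Ha|]. split; [exact Hf|]. intros k. simpl plus.
  replace (INR (fact (0 + k)) / INR (fact k)) with 1 by (simpl; field; apply INR_fact_neq_0).
  symmetry. exact (scal_one (K := R_AbsRing) (a k)).
- destruct IH as (b & Hb & Hs & E). exists (coef_deriv b).
  split; [now apply coef_deriv_summable|]. split; [now apply oct_series_slice_deriv|].
  intros k. unfold coef_deriv. rewrite E.
  rewrite (scal_assoc (INR (S k)) (INR (fact (n + S k)) / INR (fact (S k))) (a (n + S k)%nat)).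
  replace (n + S k)%nat with (S n + k)%nat by lia. f_equal.
  change (INR (S k) * (INR (fact (S n + k)) / INR (fact (S k))) = INR (fact (S n + k)) / INR (fact k)).
  rewrite (fact_simpl k), mult_INR. field. split; [apply INR_fact_neq_0|].
  apply not_0_INR. lia.
Qed.

Lemma slice_deriv_n_0 (n : nat) (a : nat -> Oct) (f : Oct -> Oct) :
  disc_summable (fun n => norm (a n)) -> oct_series a f ->
  norm (slice_deriv_n n f Ozero) / INR (fact n) = norm (a n).
Proof.
intros Ha Hf. destruct (slice_deriv_n_series n a f Ha Hf) as (b & _ & Hs & E).
rewrite (oct_series_0 b _ Hs), E, norm_Oscal, Nat.add_0_r. simpl (fact 0).
pose proof (INR_fact_lt_0 n).
rewrite Rabs_pos_eq; simpl; [field; lra|]. rewrite Rdiv_1_r. lra.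
Qed.

(** * Fourier coefficients on circles *)

(** For terms depending on [t] under a majorant that does not, this is the uniformity that
    [is_series_RInt] requires. *)
Lemma series_tail_le (a d : nat -> R) (l : R) (n : nat) :
  is_series a l -> (forall k, Rabs (a k) <= d k) -> ex_series d ->
  Rabs (sum_n a n - l) <= Series d - sum_n d n.
Proof.
intros Ha H Hd. apply Series_correct in Hd.
assert (L : is_lim_seq (fun m => Rabs (sum_n a n - sum_n a m)) (Rabs (sum_n a n - l))).
{ apply (is_lim_seq_abs _ (sum_n a n - l)). apply is_lim_seq_minus'; [apply is_lim_seq_const|exact Ha]. }
assert (L2 : is_lim_seq (fun m => sum_n d m - sum_n d n) (Series d - sum_n d n)).
{ apply is_lim_seq_minus'; [exact Hd|apply is_lim_seq_const]. }
refine (is_lim_seq_le_loc _ _ _ _ _ L L2 : Rbar_le (Rabs _) (Series d - sum_n d n)).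
exists n. intros m Hm. induction Hm as [|m Hm IH].
- rewrite !Rminus_eq_0, Rabs_R0. lra.
- rewrite !sum_Sn. change plus with Rplus.
  replace (sum_n a n - (sum_n a m + a (S m))) with (sum_n a n - sum_n a m + - a (S m)) by ring.
  eapply Rle_trans; [apply Rabs_triang|]. rewrite Rabs_Ropp. specialize (H (S m)). lra.
Qed.

Section Fourier.

Context (I : Oct) (r : R) (E : nat -> Oct) (W : R -> Oct).
Hypothesis (HI : imag_unit I) (Hr : 0 < r < 1) (HE : disc_summable (fun k => norm (E k))).
Hypothesis (HW : forall t p,
  is_series (fun k => ip (act I ((r * cis t) ^ k) (E k)) p) (ip (W t) p)).

Lemma fourier_term (j : Z) (q : Oct) (k : nat) (t : R) :
  ip (act I ((r * cis t) ^ k) (E k)) (act I (cis (IZR j * t)) q) =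
  (r ^ k * ip (E k) q) * cos (IZR (Z.of_nat k - j) * t)
  + (- (r ^ k * ip (E k) (Omult I q))) * sin (IZR (Z.of_nat k - j) * t).
Proof.
assert (Ec : cis (IZR j * t) = Cconj (cis (- (IZR j * t)))).
{ unfold cis, Cconj. simpl. now rewrite cos_neg, sin_neg, Ropp_involutive. }
rewrite Ec, <- (ip_act_conj I HI), <- (act_mult I HI), Cpow_mult_l, cis_pow, <- RtoC_pow.
replace (cis (- (IZR j * t)) * (RtoC (r ^ k) * cis (INR k * t)))%C
  with (RtoC (r ^ k) * (cis (- (IZR j * t)) * cis (INR k * t)))%C by ring.
rewrite <- cis_plus.
replace (- (IZR j * t) + INR k * t) with (IZR (Z.of_nat k - j) * t)
  by (rewrite minus_IZR, <- INR_IZR_INZ; ring).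
rewrite (ip_act I HI). generalize (IZR (Z.of_nat k - j) * t) (r ^ k). intros s m.
unfold cis. simpl. ring.
Qed.

(** [j] is an integer because [test_weighted] also pairs [W] with the frequency 2 n - k, which may
    be negative and then gives 0. *)
Lemma is_RInt_fourier (j : Z) (q : Oct) :
  is_RInt (fun t => ip (W t) (act I (cis (IZR j * t)) q)) 0 (2 * PI)
    (if Z_le_dec 0 j then 2 * PI * (r ^ Z.to_nat j * ip (E (Z.to_nat j)) q) else 0).
Proof.
pose proof PI_RGT_0 as HPI.
set (d := fun k => norm (E k) * r ^ k * norm q).
assert (Hd : ex_series d).
{ apply (ex_series_ext (fun k => scal (norm q) (Rabs (norm (E k) * r ^ k)))).
  - intros k. unfold d. rewrite Rabs_pos_eq.
    + apply Rmult_comm.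
    + apply Rmult_le_pos; [apply norm_ge_0|apply pow_le; lra].
  - apply (ex_series_scal (V := R_NormedModule) (norm q)), (disc_summable_abs _ r HE).
    rewrite Rabs_pos_eq; lra. }
set (J := fun k : nat => if Z.eq_dec (Z.of_nat k - j) 0 then 2 * PI * (r ^ k * ip (E k) q) else 0).
destruct (is_series_RInt
  (fun k t => ip (act I ((r * cis t) ^ k) (E k)) (act I (cis (IZR j * t)) q))
  (fun t => ip (W t) (act I (cis (IZR j * t)) q)) J
  (fun n => Series d - sum_n d n) 0 (2 * PI)) as [X S].
- lra.
- intros k. eapply is_RInt_ext; [|apply (is_RInt_trig (Z.of_nat k - j) (r ^ k * ip (E k) q)
    (- (r ^ k * ip (E k) (Omult I q))))].
  intros t _. symmetry. apply fourier_term.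
- intros n t _.
  apply (series_tail_le (fun k => ip (act I ((r * cis t) ^ k) (E k)) (act I (cis (IZR j * t)) q)) d _ n);
    [apply HW| |exact Hd].
  intros k. eapply Rle_trans; [apply abs_ip_le_norm|].
  rewrite !(norm_act I HI), Cmod_pow, Cmod_mult, !Cmod_cis, Cmod_R, (Rabs_pos_eq r) by lra.
  rewrite Rmult_1_r, Rmult_1_l. unfold d. right. ring.
- apply Series_correct in Hd.
  replace (Finite 0) with (Finite (Series d - Series d)) by (f_equal; ring).
  apply is_lim_seq_minus'; [apply is_lim_seq_const|exact Hd].
- set (l := if Z_le_dec 0 j then 2 * PI * (r ^ Z.to_nat j * ip (E (Z.to_nat j)) q) else 0).
  (* The only index that can contribute is [j], so the series of integrals is a finite sum. *)
  assert (SJ : is_series J (sum_n J (Z.to_nat j))).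
  { apply is_series_finite. intros n Hn. unfold J.
    destruct (Z.eq_dec (Z.of_nat n - j) 0); [lia|reflexivity]. }
  assert (EJ : sum_n J (Z.to_nat j) = l).
  { assert (Z0 : forall n, (n < Z.to_nat j)%nat -> sum_n J n = 0).
    { induction n as [|n IH]; intros Hn.
      - rewrite sum_O. unfold J. destruct (Z.eq_dec _ _); [lia|reflexivity].
      - rewrite sum_Sn, IH by lia. unfold J. destruct (Z.eq_dec _ _); [lia|].
        exact (Rplus_0_l 0). }
    assert (EJ : sum_n J (Z.to_nat j) = J (Z.to_nat j)).
    { destruct (Z.to_nat j) as [|n] eqn:En; [apply sum_O|].
      rewrite sum_Sn, Z0 by lia. exact (Rplus_0_l _). }
    rewrite EJ. unfold J, l. destruct (Z_le_dec 0 j), (Z.eq_dec _ _); try lia; reflexivity. }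
  match goal with |- is_RInt ?f ?a ?b _ => change (is_RInt f a b l) end.
  rewrite <- EJ, <- (is_series_unique _ _ SJ), (is_series_unique _ _ S).
  exact (RInt_correct (V := R_CompleteNormedModule) _ _ _ X).
Qed.

Lemma is_RInt_fourier_nat (n : nat) (q : Oct) :
  is_RInt (fun t => ip (W t) (act I (cis (INR n * t)) q)) 0 (2 * PI)
    (2 * PI * (r ^ n * ip (E n) q)).
Proof.
pose proof (is_RInt_fourier (Z.of_nat n) q) as H. rewrite Nat2Z.id, <- INR_IZR_INZ in H.
destruct (Z_le_dec 0 (Z.of_nat n)); [exact H|lia].
Qed.

Context (d : R).
Hypothesis (Wd : forall t, norm (W t) <= d).

Lemma average_le (f g : R -> R) (a b : R) :
  (forall t, f t <= g t) -> is_RInt f 0 (2 * PI) (2 * PI * a) ->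
  is_RInt g 0 (2 * PI) (2 * PI * b) -> a <= b.
Proof.
intros H Hf Hg. pose proof PI_RGT_0.
apply (Rmult_le_reg_l (2 * PI)); [lra|].
apply (is_RInt_le f g 0 (2 * PI)); [lra|exact Hf|exact Hg|]. intros t _. apply H.
Qed.

Lemma is_RInt_constant (c : R) : is_RInt (fun _ => c) 0 (2 * PI) (2 * PI * c).
Proof.
pose proof (is_RInt_const (V := R_NormedModule) 0 (2 * PI) c) as H.
rewrite Rminus_0_r in H. exact H.
Qed.

Lemma test_one_frequency (n : nat) (q : Oct) : r ^ n * ip (E n) q <= d * norm q.
Proof.
refine (average_le _ _ _ _ _ (is_RInt_fourier_nat n q) (is_RInt_constant (d * norm q))).
intros t. eapply Rle_trans; [apply ip_le_norm|].
rewrite (norm_act I HI), Cmod_cis, Rmult_1_l.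
apply Rmult_le_compat_r; [apply norm_ge_0|apply Wd].
Qed.

(** Pointwise d |T| <= d^2 / 4 + |T|^2, and the cross term of |T|^2 oscillates with frequency n - k,
    so it averages to 0. The quadratic right side is what a small perturbation in [q] is played
    against. *)
Lemma test_two_frequencies (n k : nat) (p q : Oct) : n <> k ->
  r ^ n * ip (E n) p + r ^ k * ip (E k) q <= d ^ 2 / 4 + norm p ^ 2 + norm q ^ 2.
Proof.
intros Hnk.
set (l := (Z.of_nat n - Z.of_nat k)%Z).
set (c := d ^ 2 / 4 + norm p ^ 2 + norm q ^ 2).
assert (IB : is_RInt (fun t => c + (2 * ip p q * cos (IZR l * t)
  + - (2 * ip p (Omult I q)) * sin (IZR l * t))) 0 (2 * PI) (2 * PI * c)).
{ pose proof (is_RInt_trig l (2 * ip p q) (- (2 * ip p (Omult I q)))) as T.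
  destruct (Z.eq_dec l 0); [unfold l in *; lia|].
  pose proof (is_RInt_plus (V := R_NormedModule) _ _ _ _ _ _ (is_RInt_constant c) T) as X.
  replace (2 * PI * c) with (plus (2 * PI * c) 0) by exact (Rplus_0_r _). exact X. }
assert (IA : is_RInt (fun t => ip (W t) (act I (cis (INR n * t)) p) + ip (W t) (act I (cis (INR k * t)) q))
  0 (2 * PI) (2 * PI * (r ^ n * ip (E n) p + r ^ k * ip (E k) q))).
{ rewrite Rmult_plus_distr_l.
  exact (is_RInt_plus (V := R_NormedModule) _ _ _ _ _ _ (is_RInt_fourier_nat n p) (is_RInt_fourier_nat k q)). }
refine (average_le _ _ _ _ _ IA IB).
intros t. rewrite <- ip_plus_r.
set (T := plus (act I (cis (INR n * t)) p) (act I (cis (INR k * t)) q)).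
assert (ET : norm T ^ 2 = norm p ^ 2 + norm q ^ 2
  + (2 * ip p q * cos (IZR l * t) + - (2 * ip p (Omult I q)) * sin (IZR l * t))).
{ rewrite <- ip_self. unfold T. rewrite ip_plus_l, !ip_plus_r, !ip_self, !(norm_act I HI), !Cmod_cis.
  rewrite (ip_comm (act I (cis (INR k * t)) q)).
  assert (Ec : cis (INR k * t) = Cconj (cis (- (INR k * t)))).
  { unfold cis, Cconj. simpl. now rewrite cos_neg, sin_neg, Ropp_involutive. }
  rewrite Ec, <- (ip_act_conj I HI), <- (act_mult I HI), <- cis_plus.
  replace (- (INR k * t) + INR n * t) with (IZR l * t)
    by (unfold l; rewrite minus_IZR, <- !INR_IZR_INZ; ring).
  rewrite (ip_act I HI). generalize (IZR l * t). intros s. unfold cis. simpl. ring. }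
eapply Rle_trans; [apply ip_le_norm|].
pose proof (norm_ge_0 T) as PT.
assert (norm (W t) * norm T <= d * norm T) by (apply Rmult_le_compat_r; [exact PT|apply Wd]).
pose proof (pow2_ge_0 (d / 2 - norm T)). unfold c. lra.
Qed.

(* Tested against [(1 + cos (K t + alpha)) e^(Int) p], whose weight is nonnegative
   with mean 1. *)
Lemma test_weighted (n k : nat) (p : Oct) (g : C) :
  (0 < n)%nat -> (2 * n <= k)%nat -> Cmod g = 1 -> E 0%nat = Ozero ->
  r ^ n * ip (E n) p + r ^ k * (1 / 2 * ip (E k) (act I g p)) <= d * norm p.
Proof.
intros Hn Hk Hg HE0.
set (K := (Z.of_nat k - Z.of_nat n)%Z). set (j := (2 * Z.of_nat n - Z.of_nat k)%Z).
set (w := fun t => fst g * cos (IZR K * t) - snd g * sin (IZR K * t)).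
(* The weight turns frequency n into n, k = n + K and j = n - K <= 0. A negative [j] meets no
   coefficient, and [j = 0] meets [E 0], which is zero. *)
assert (I3 : is_RInt (fun t => ip (W t) (act I (cis (IZR j * t)) (act I (Cconj g) p))) 0 (2 * PI) 0).
{ pose proof (is_RInt_fourier j (act I (Cconj g) p)) as H.
  destruct (Z_le_dec 0 j); [|exact H].
  replace (Z.to_nat j) with 0%nat in H by (unfold j in *; lia).
  rewrite HE0, ip_zero_l, !Rmult_0_r in H. exact H. }
assert (IA : is_RInt (fun t => ip (W t) (act I (cis (INR n * t)) p) +
  1 / 2 * (ip (W t) (act I (cis (INR k * t)) (act I g p))
    + ip (W t) (act I (cis (IZR j * t)) (act I (Cconj g) p)))) 0 (2 * PI)
  (2 * PI * (r ^ n * ip (E n) p + r ^ k * (1 / 2 * ip (E k) (act I g p))))).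
{ pose proof (is_RInt_plus (V := R_NormedModule) _ _ _ _ _ _ (is_RInt_fourier_nat n p)
    (is_RInt_scal (V := R_NormedModule) _ _ _ (1 / 2) _
      (is_RInt_plus (V := R_NormedModule) _ _ _ _ _ _ (is_RInt_fourier_nat k (act I g p)) I3))) as X.
  match type of X with is_RInt _ _ _ ?v => match goal with |- is_RInt _ _ _ ?v' => replace v' with v end end.
  - exact X.
  - change (2 * PI * (r ^ n * ip (E n) p) + 1 / 2 * (2 * PI * (r ^ k * ip (E k) (act I g p)) + 0)
      = 2 * PI * (r ^ n * ip (E n) p + r ^ k * (1 / 2 * ip (E k) (act I g p)))). field. }
assert (IB : is_RInt (fun t => d * norm p * (1 + w t)) 0 (2 * PI) (2 * PI * (d * norm p))).
{ pose proof (is_RInt_trig K (d * norm p * fst g) (- (d * norm p * snd g))) as T.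
  destruct (Z.eq_dec K 0); [unfold K in *; lia|].
  pose proof (is_RInt_plus (V := R_NormedModule) _ _ _ _ _ _ (is_RInt_constant (d * norm p)) T) as X.
  replace (2 * PI * (d * norm p)) with (plus (2 * PI * (d * norm p)) 0) by exact (Rplus_0_r _).
  eapply is_RInt_ext; [|exact X]. intros t _.
  change (d * norm p + (d * norm p * fst g * cos (IZR K * t) + - (d * norm p * snd g) * sin (IZR K * t))
    = d * norm p * (1 + w t)). unfold w. ring. }
refine (average_le _ _ _ _ _ IA IB).
intros t.
assert (ET : ip (W t) (act I (cis (INR n * t)) p) +
  1 / 2 * (ip (W t) (act I (cis (INR k * t)) (act I g p))
    + ip (W t) (act I (cis (IZR j * t)) (act I (Cconj g) p)))
  = (1 + w t) * ip (W t) (act I (cis (INR n * t)) p)).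
{ rewrite <- ip_plus_r, <- !(act_mult I HI), <- (act_plus I HI).
  (* Here [w t] is the real part of g e^(iKt), half the sum of that number and its conjugate. *)
  assert (Ew : (cis (INR k * t) * g + cis (IZR j * t) * Cconj g)%C = (RtoC (2 * w t) * cis (INR n * t))%C).
  { replace (INR k * t) with (INR n * t + IZR K * t)
      by (unfold K; rewrite minus_IZR, <- !INR_IZR_INZ; ring).
    replace (IZR j * t) with (INR n * t + - (IZR K * t))
      by (unfold K, j; rewrite !minus_IZR, mult_IZR, <- !INR_IZR_INZ; ring).
    rewrite !cis_plus. unfold w. generalize (IZR K * t) (INR n * t). intros s m.
    unfold cis. rewrite cos_neg, sin_neg.
    apply injective_projections; simpl; ring. }
  rewrite Ew, (act_mult I HI).
  assert (Es : forall o, act I (RtoC (2 * w t)) o = scal (2 * w t) o).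
  { intros o. apply ip_ext. intros s. rewrite (ip_act I HI), ip_scal_l. simpl. ring. }
  rewrite Es, ip_scal_r. field. }
rewrite ET.
assert (Pw : 0 <= 1 + w t).
{ assert (Rabs (w t) <= 1).
  { pose proof (re_le_Cmod (g * cis (IZR K * t))) as B.
    rewrite Cmod_mult, Hg, Cmod_cis, Rmult_1_l in B. exact B. }
  apply Rabs_le_between in H. lra. }
rewrite (Rmult_comm (d * norm p)). apply Rmult_le_compat_l; [exact Pw|].
eapply Rle_trans; [apply ip_le_norm|].
rewrite (norm_act I HI), Cmod_cis, Rmult_1_l.
apply Rmult_le_compat_r; [apply norm_ge_0|apply Wd].
Qed.

End Fourier.

(** * The coefficient bound and its equality case *)

Lemma continuity_pt_le (f : R -> R) (x c : R) :
  continuity_pt f x -> (forall e, 0 < e -> exists y, Rabs (y - x) < e /\ f y <= c) -> f x <= c.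
Proof.
intros Hf H. apply Rnot_lt_le. intros L.
destruct (Hf (f x - c)) as (e & He & HH); [lra|].
destruct (H e He) as (y & Hy & Hc).
destruct (Req_dec y x) as [->|N]; [lra|].
specialize (HH y (conj (conj Logic.I (not_eq_sym N)) Hy)).
change (Rabs (f y - f x) < f x - c) in HH. apply Rabs_lt_between in HH. lra.
Qed.

(** The tests live on circles inside the ball; this lets their radius tend to 1. *)
Lemma le_of_radii (n k : nat) (a b c : R) :
  (forall r, 0 < r < 1 -> r ^ n * a + r ^ k * b <= c) -> a + b <= c.
Proof.
intros H.
assert (L : (fun r => r ^ n * a + r ^ k * b) 1 <= c).
{ refine (continuity_pt_le (fun r => r ^ n * a + r ^ k * b) 1 c _ _).
  - apply continuity_pt_filterlim.
    apply (ex_derive_continuous (V := R_NormedModule) (fun r => r ^ n * a + r ^ k * b) 1).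
    auto_derive; trivial.
  - intros e He. exists (1 - Rmin (e / 2) (1 / 2)).
    assert (0 < Rmin (e / 2) (1 / 2)) by (apply Rmin_glb_lt; lra).
    pose proof (Rmin_l (e / 2) (1 / 2)). pose proof (Rmin_r (e / 2) (1 / 2)).
    split; [apply Rabs_def1; lra|]. apply H. lra. }
cbv beta in L. rewrite !pow1 in L. lra.
Qed.

Section Extremal.

Context (f : Oct -> Oct) (a : nat -> Oct) (d : R).
Hypothesis (Ha : disc_summable (fun n => norm (a n))) (Hf : oct_series a f).
Hypothesis (Hd : forall z w, unit_ball z -> unit_ball w -> norm (minus (f z) (f w)) <= d).

(** The k-th coefficient of f(z) - f(z e^(I theta)) on the slice of [I]. *)
Definition rotation_coef (I : Oct) (theta : R) (k : nat) : Oct :=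
  act I (1 - cis (INR k * theta)) (a k).

Definition rotation_diff (I : Oct) (theta r t : R) : Oct :=
  minus (f (slice_pt I (r * cos t) (r * sin t)))
    (f (slice_pt I (r * cos (t + theta)) (r * sin (t + theta)))).

Lemma rotation_diff_le (I : Oct) (theta r t : R) :
  imag_unit I -> 0 < r < 1 -> norm (rotation_diff I theta r t) <= d.
Proof.
intros HI Hr. apply Hd; apply (unit_ball_slice_pt I HI), circle_in_disc; lra.
Qed.

Lemma rotation_coef_summable (I : Oct) (theta : R) :
  imag_unit I -> disc_summable (fun k => norm (rotation_coef I theta k)).
Proof.
intros HI. apply (disc_summable_le _ _ 2 Ha). intros k.
unfold rotation_coef. rewrite (norm_act I HI), Rabs_mult, (Rabs_pos_eq (Cmod _)) by apply Cmod_ge_0.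
apply Rmult_le_compat_r; [apply Rabs_pos|].
pose proof (Cmod_triangle 1 (- cis (INR k * theta))) as T.
rewrite Cmod_1, Cmod_opp, Cmod_cis in T. exact T.
Qed.

Lemma rotation_diff_series (I : Oct) (theta r t : R) (p : Oct) :
  imag_unit I -> 0 < r < 1 ->
  is_series (fun k => ip (act I ((r * cis t) ^ k) (rotation_coef I theta k)) p)
    (ip (rotation_diff I theta r t) p).
Proof.
intros HI Hr. unfold rotation_diff. rewrite ip_minus_l.
assert (B : forall s, (r * cos s) ^ 2 + (r * sin s) ^ 2 < 1) by (intros s; apply circle_in_disc; lra).
assert (C : forall s, ((r * cos s)%R, (r * sin s)%R) = (r * cis s)%C).
{ intros s. unfold cis. apply injective_projections; simpl; ring. }
pose proof (is_series_minus _ _ _ _ (Hf I _ _ p HI (B t)) (Hf I _ _ p HI (B (t + theta)))) as S.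
eapply is_series_ext; [|exact S]. intros k. cbv beta. rewrite !C.
unfold rotation_coef. rewrite <- (act_mult I HI).
assert (E : ((r * cis t) ^ k * (1 - cis (INR k * theta)))%C
  = ((r * cis t) ^ k - (r * cis (t + theta)) ^ k)%C).
{ rewrite !Cpow_mult_l, !cis_pow, Rmult_plus_distr_l, cis_plus. ring. }
rewrite E, !(ip_act I HI). generalize ((r * cis t) ^ k)%C ((r * cis (t + theta)) ^ k)%C.
intros u v. unfold minus, plus, opp. simpl. eqR. ring.
Qed.

Lemma rotation_test_one (I : Oct) (theta : R) (n : nat) : imag_unit I ->
  norm (rotation_coef I theta n) <= d.
Proof.
intros HI.
assert (Pd : 0 <= d).
{ eapply Rle_trans; [|exact (rotation_diff_le I 0 (1 / 2) 0 HI ltac:(lra))].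
  exact (norm_ge_0 (V := Oct_NM) _). }
apply norm_ip_bound; [exact Pd|].
set (q := rotation_coef I theta n).
assert (L : ip q q + 0 <= d * norm q); [|lra].
apply (le_of_radii n n). intros r Hr. rewrite Rmult_0_r, Rplus_0_r.
exact (test_one_frequency I r (rotation_coef I theta) (rotation_diff I theta r) HI Hr
  (rotation_coef_summable I theta HI) (fun t p => rotation_diff_series I theta r t p HI Hr)
  d (fun t => rotation_diff_le I theta r t HI Hr) n q).
Qed.

Lemma rotation_test_two (I : Oct) (theta : R) (n k : nat) (p q : Oct) : imag_unit I -> n <> k ->
  ip (rotation_coef I theta n) p + ip (rotation_coef I theta k) q
  <= d ^ 2 / 4 + norm p ^ 2 + norm q ^ 2.
Proof.
intros HI Hnk. apply (le_of_radii n k). intros r Hr.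
exact (test_two_frequencies I r (rotation_coef I theta) (rotation_diff I theta r) HI Hr
  (rotation_coef_summable I theta HI) (fun t p => rotation_diff_series I theta r t p HI Hr)
  d (fun t => rotation_diff_le I theta r t HI Hr) n k p q Hnk).
Qed.

Lemma rotation_test_weighted (I : Oct) (theta : R) (n k : nat) (p : Oct) (g : C) :
  imag_unit I -> (0 < n)%nat -> (2 * n <= k)%nat -> Cmod g = 1 ->
  ip (rotation_coef I theta n) p + 1 / 2 * ip (rotation_coef I theta k) (act I g p)
  <= d * norm p.
Proof.
intros HI Hn Hk Hg. apply (le_of_radii n k). intros r Hr.
assert (H0 : rotation_coef I theta 0 = Ozero).
{ unfold rotation_coef. simpl INR. rewrite Rmult_0_l, cis_0.
  apply ip_ext. intros s. rewrite (ip_act I HI), ip_zero_l. simpl. ring. }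
exact (test_weighted I r (rotation_coef I theta) (rotation_diff I theta r) HI Hr
  (rotation_coef_summable I theta HI) (fun t p => rotation_diff_series I theta r t p HI Hr)
  d (fun t => rotation_diff_le I theta r t HI Hr) n k p g Hn Hk Hg H0).
Qed.

Lemma cis_PI : cis PI = (- (1))%C.
Proof. unfold cis. rewrite cos_PI, sin_PI. apply injective_projections; simpl; ring. Qed.

Lemma coef_le_half_diameter (n : nat) : (0 < n)%nat -> norm (a n) <= 1 / 2 * d.
Proof.
intros Hn. pose proof (rotation_test_one Oi (PI / INR n) n imag_unit_Oi) as H.
unfold rotation_coef in H. rewrite (norm_act Oi imag_unit_Oi) in H.
replace (INR n * (PI / INR n)) with PI in H by (field; apply not_0_INR; lia).
rewrite cis_PI in H. replace (1 - - (1))%C with (RtoC 2) in H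
  by (apply injective_projections; simpl; ring).
rewrite Cmod_R, Rabs_pos_eq in H by lra. lra.
Qed.

(** Since 1 - cos x = 2 sin^2(x / 2), the value 1 is not attained inside (0, 2 pi). At x = k pi / n
    this turns the surviving frequencies into k >= 2 n. *)
Lemma cis_1_multiple (x : R) : 0 < x -> cis x = RtoC 1 -> 2 * PI <= x.
Proof.
intros Hx E. apply Rnot_lt_le. intros L.
apply (f_equal fst) in E. unfold cis in E. simpl in E.
replace x with (2 * (x / 2)) in E by field. rewrite cos_2a_sin in E.
assert (0 < sin (x / 2)) by (apply sin_gt_0; lra).
assert (0 < sin (x / 2) * sin (x / 2)) by now apply Rmult_lt_0_compat. lra.
Qed.

(* At angle [pi / n], equality for [a n] leaves no room for the frequency [k]
   unless [e^(i k pi / n) = 1]. *)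
Lemma extremal_frequency (n k : nat) :
  (0 < n)%nat -> (0 < k)%nat -> k <> n -> norm (a n) = 1 / 2 * d -> a k <> Ozero ->
  cis (INR k * (PI / INR n)) = RtoC 1.
Proof.
intros Hn Hk Hkn He Nk.
assert (Nn : INR n <> 0) by (apply not_0_INR; lia).
set (q := rotation_coef Oi (PI / INR n) k).
(* With p = a_n all terms free of [q] balance exactly, leaving |q|^2 / 2 <= |q|^2 / 4; the factor 1
   / 2 makes the linear term win. *)
pose proof (rotation_test_two Oi (PI / INR n) n k (a n) (scal (1 / 2) q) imag_unit_Oi
  (not_eq_sym Hkn)) as H.
fold q in H. rewrite ip_scal_r, ip_self, norm_Oscal, (Rabs_pos_eq (1 / 2)), He in H by lra.
assert (E : ip (rotation_coef Oi (PI / INR n) n) (a n) = 2 * (1 / 2 * d) ^ 2).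
{ unfold rotation_coef. replace (INR n * (PI / INR n)) with PI by now field.
  rewrite (ip_act Oi imag_unit_Oi), ip_self, He, cis_PI. simpl. ring. }
rewrite E in H.
assert (Q : norm q = 0).
{ apply Rsqr_0_uniq. unfold Rsqr. pose proof (pow2_ge_0 (norm q)). simpl in *. lra. }
unfold q, rotation_coef in Q. rewrite (norm_act Oi imag_unit_Oi) in Q.
apply Rmult_integral in Q. destruct Q as [Q|Q].
- apply Cmod_eq_0 in Q. set (z := cis _) in *.
  replace z with (1 - (1 - z))%C by ring. rewrite Q. ring.
- now apply norm_Oct_eq0 in Q.
Qed.

Lemma extremal_coef (n k : nat) :
  (0 < n)%nat -> (0 < k)%nat -> k <> n -> norm (a n) = 1 / 2 * d -> a k = Ozero.
Proof.
intros Hn Hk Hkn He.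
destruct (Req_dec (norm (a k)) 0) as [Z|Z]; [now apply norm_Oct_eq0|exfalso].
assert (Nk : a k <> Ozero).
{ intros E. apply Z. rewrite E. exact (norm_zero (V := Oct_NM)). }
pose proof (extremal_frequency n k Hn Hk Hkn He Nk) as Ck.
pose proof (coef_le_half_diameter k Hk) as Bk. pose proof (norm_ge_0 (a k)) as Pk.
assert (Pd : 0 < d) by lra.
assert (pn : 0 < INR n) by (apply lt_0_INR; lia).
assert (pk : 0 < INR k) by (apply lt_0_INR; lia).
pose proof PI_RGT_0 as HPI.
assert (H2n : 2 * INR n <= INR k).
{ apply cis_1_multiple in Ck.
  - apply (Rmult_le_reg_r (PI / INR n)); [apply Rdiv_lt_0_compat; lra|].
    replace (2 * INR n * (PI / INR n)) with (2 * PI) by (field; lra). exact Ck.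
  - apply Rmult_lt_0_compat; [exact pk|]. apply Rdiv_lt_0_compat; lra. }
assert (H2k : (2 * n <= k)%nat) by (apply INR_le; rewrite mult_INR; exact H2n).
assert (Nan : a n <> Ozero).
{ intros E. rewrite E in He. assert (norm Ozero = 0) by exact (norm_zero (V := Oct_NM)). lra. }
(* The slice is adapted to the pair: there a_k is the complex multiple c of a_n, and c must be shown
   to vanish. *)
destruct (act_transitive (a n) (a k) Nan) as (I & c & HI & Ec).
assert (Pc : 0 < Cmod c).
{ rewrite Ec, (norm_act I HI) in Z. pose proof (Cmod_ge_0 c).
  destruct (Req_dec (Cmod c) 0) as [E|E]; [|lra]. rewrite E, Rmult_0_l in Z. now contradict Z. }
(* The phase for which conj(g) c = i |c|: then 1 - e^(i eta), close to -i eta, contributes |c| sin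
   eta with positive sign. *)
set (g := (- Ci * c / RtoC (Cmod c))%C).
assert (Nc : RtoC (Cmod c) <> RtoC 0).
{ intros E. apply (f_equal fst) in E. simpl in E. lra. }
assert (Hg : Cmod g = 1).
{ unfold g. rewrite Cmod_div, Cmod_mult, Cmod_opp, Cmod_R, Rabs_pos_eq by (exact Nc || lra).
  replace (Cmod Ci) with 1; [field; lra|].
  unfold Cmod, Ci; simpl fst; simpl snd. rewrite <- sqrt_1 at 1. f_equal. ring. }
assert (Hcg : (Cconj g * c)%C = (Ci * RtoC (Cmod c))%C).
{ assert (Cc : (Cconj c * c)%C = (RtoC (Cmod c) * RtoC (Cmod c))%C).
  { rewrite <- RtoC_mult. unfold Cmod. rewrite sqrt_sqrt
      by (apply Rplus_le_le_0_compat; apply pow2_ge_0).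
    apply injective_projections; simpl; ring. }
  assert (Eg : Cconj g = (Ci * Cconj c / RtoC (Cmod c))%C).
  { unfold g, Cdiv. rewrite <- RtoC_inv by lra. apply injective_projections; simpl; ring. }
  rewrite Eg. replace (Ci * Cconj c / RtoC (Cmod c) * c)%C
    with (Ci * (Cconj c * c) / RtoC (Cmod c))%C by (field; exact Nc).
  rewrite Cc. field. exact Nc. }
(* [delta] is the excess angle at frequency n and [eta] = k delta / n the one at frequency k.
   Requiring [eta <= 1] keeps the half angles where the sine increases. *)
assert (K : forall eta, 0 < eta <= 1 -> Cmod c * cos (eta / 2) <= 2 * sin (eta / 2)).
{ intros eta Heta.
  set (delta := INR n * eta / INR k).
  assert (Hdelta : 0 < delta <= eta).
  { unfold delta. split.
    - apply Rdiv_lt_0_compat; [apply Rmult_lt_0_compat; lra|exact pk].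
    - apply Rle_div_l; [exact pk|]. rewrite Rmult_comm. apply Rmult_le_compat_l; lra. }
  pose proof (rotation_test_weighted I ((PI + delta) / INR n) n k (a n) g HI Hn H2k Hg) as H.
  assert (En : ip (rotation_coef I ((PI + delta) / INR n) n) (a n)
    = (1 + cos delta) * norm (a n) ^ 2).
  { unfold rotation_coef. replace (INR n * ((PI + delta) / INR n)) with (PI + delta) by (field; lra).
    rewrite cis_plus, cis_PI, <- ip_self, (ip_act I HI).
    assert (O : ip (a n) (Omult I (a n)) = 0).
    { pose proof (ip_imag_unit I (a n) (a n) HI) as O. rewrite ip_comm in O. lra. }
    rewrite O. unfold cis. simpl. ring. }
  assert (Ek : ip (rotation_coef I ((PI + delta) / INR n) k) (act I g (a n))
    = Cmod c * sin eta * norm (a n) ^ 2).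
  { unfold rotation_coef. rewrite Ec.
    replace (INR k * ((PI + delta) / INR n)) with (INR k * (PI / INR n) + eta)
      by (unfold delta; field; lra).
    rewrite cis_plus, Ck.
    replace g with (Cconj (Cconj g)) by (apply injective_projections; simpl; ring).
    rewrite <- (ip_act_conj I HI), <- !(act_mult I HI).
    replace (Cconj g * (1 - RtoC 1 * cis eta) * c)%C with ((1 - cis eta) * (Cconj g * c))%C by ring.
    rewrite Hcg, <- ip_self, (ip_act I HI).
    assert (O : ip (a n) (Omult I (a n)) = 0).
    { pose proof (ip_imag_unit I (a n) (a n) HI) as O. rewrite ip_comm in O. lra. }
    rewrite O. unfold cis. simpl. ring. }
  rewrite En, Ek, He in H.
  (* The gain is of first order in eta and the loss of second order in delta <= eta. Half-angle
     formulas and division by 2 sin (eta / 2) leave the claim. *)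
  assert (H' : Cmod c * sin eta <= 2 * (1 - cos delta)).
  { apply (Rmult_le_reg_r (1 / 2 * (1 / 2 * d) ^ 2)).
    - apply Rmult_lt_0_compat; [lra|]. apply pow_lt. lra.
    - lra. }
  replace eta with (2 * (eta / 2)) in H' by field.
  replace delta with (2 * (delta / 2)) in H' by field.
  rewrite sin_2a, cos_2a_sin in H'.
  pose proof PI2_1. unfold Rdiv in H0.
  assert (S1 : sin (delta / 2) <= sin (eta / 2)) by (apply sin_incr_1; lra).
  assert (S2 : 0 < sin (delta / 2)) by (apply sin_gt_0; lra).
  assert (S3 : sin (delta / 2) * sin (delta / 2) <= sin (eta / 2) * sin (eta / 2))
    by (apply Rmult_le_compat; lra).
  apply (Rmult_le_reg_l (2 * sin (eta / 2))); lra. }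
(* Letting eta tend to 0 gives |c| <= 0. *)
assert (L : (fun x => Cmod c * cos x - 2 * sin x) 0 <= 0).
{ refine (continuity_pt_le (fun x => Cmod c * cos x - 2 * sin x) 0 0 _ _).
  - apply continuity_pt_filterlim.
    apply (ex_derive_continuous (V := R_NormedModule) (fun x => Cmod c * cos x - 2 * sin x) 0).
    auto_derive; trivial.
  - intros e Hpe. exists (Rmin (e / 2) (1 / 2)).
    assert (0 < Rmin (e / 2) (1 / 2)) by (apply Rmin_glb_lt; lra).
    pose proof (Rmin_l (e / 2) (1 / 2)). pose proof (Rmin_r (e / 2) (1 / 2)).
    split; [apply Rabs_def1; lra|].
    specialize (K (2 * Rmin (e / 2) (1 / 2)) ltac:(lra)).
    replace (2 * Rmin (e / 2) (1 / 2) / 2) with (Rmin (e / 2) (1 / 2)) in K by field. lra. }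
cbv beta in L. rewrite cos_0, sin_0 in L. lra.
Qed.

End Extremal.

(** * The diameter of the image and the extremal functions *)

Lemma unit_ball_Ozero : unit_ball Ozero.
Proof.
unfold unit_ball. rewrite (norm_zero (V := Oct_NM) : norm Ozero = 0). lra.
Qed.

Lemma diameter_image (f : Oct -> Oct) : bounded_on unit_ball f ->
  forall z w, unit_ball z -> unit_ball w ->
  norm (minus (f z) (f w)) <= diameter (image f unit_ball).
Proof.
intros [M HM] z w Hz Hw.
destruct (diameter_is_lub (image f unit_ball) M) as [ub _].
- exists (f Ozero), Ozero. split; [exact unit_ball_Ozero|reflexivity].
- intros u (v & Hv & ->). now apply HM.
- apply ub. exists (f z), (f w). repeat split; [now exists z|now exists w].
Qed.

Lemma exists_angle (x y : R) : 0 <= y -> x ^ 2 + y ^ 2 = 1 ->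
  exists theta, cos theta = x /\ sin theta = y.
Proof.
intros Hy H. pose proof (pow2_ge_0 x). pose proof (pow2_ge_0 y).
assert (Hx : -1 <= x <= 1) by (split; nra).
exists (acos x). split; [now apply cos_acos|].
rewrite sin_acos by exact Hx. rewrite <- (sqrt_Rsqr y Hy). f_equal. unfold Rsqr. lra.
Qed.

Lemma exists_Oexp (p : Oct) : norm p = 1 ->
  exists (I : Oct) (theta : R), imag_unit I /\ p = Oexp I theta.
Proof.
intros Hp. destruct (slice_pt_surj p) as (I & x & y & HI & Hy & E).
destruct (exists_angle x y Hy) as (theta & <- & <-); [|now exists I, theta].
rewrite E, (slice_pt_act I), (norm_act I HI), norm_Oone, Rmult_1_r in Hp.
unfold Cmod in Hp. simpl fst in Hp; simpl snd in Hp.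
rewrite <- (pow2_sqrt (x ^ 2 + y ^ 2)).
- rewrite Hp. ring.
- apply Rplus_le_le_0_compat; apply pow2_ge_0.
Qed.

Lemma norm_Oexp (I : Oct) (theta : R) : imag_unit I -> norm (Oexp I theta) = 1.
Proof.
intros HI. unfold Oexp. rewrite slice_pt_act, (norm_act I HI), norm_Oone.
fold (cis theta). rewrite Cmod_cis. ring.
Qed.

(** Coefficients of p + w^n q for n > 0, used in both directions of the equality case. *)
Definition two_coefs (p q : Oct) (n k : nat) : Oct :=
  if Nat.eq_dec k 0 then p else if Nat.eq_dec k n then q else Ozero.

Lemma two_coefs_summable (p q : Oct) (n : nat) :
  disc_summable (fun k => norm (two_coefs p q n k)).
Proof.
apply disc_summable_intro. intros x _.
apply (is_lim_seq_ext_loc (fun _ => 0)); [|apply is_lim_seq_const].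
exists (S n). intros k Hk. unfold two_coefs.
destruct (Nat.eq_dec k 0); [lia|]. destruct (Nat.eq_dec k n); [lia|].
rewrite (norm_zero (V := Oct_NM) : norm Ozero = 0). now rewrite Rmult_0_l.
Qed.

Lemma two_coefs_series (I p q r : Oct) (z : C) (n : nat) : imag_unit I -> (0 < n)%nat ->
  is_series (fun k => ip (act I (z ^ k) (two_coefs p q n k)) r) (ip (plus p (act I (z ^ n) q)) r).
Proof.
intros HI Hn.
set (b := fun k => ip (act I (z ^ k) (two_coefs p q n k)) r).
assert (Bz : forall k, k <> 0%nat -> k <> n -> b k = 0).
{ intros k H0 H1. unfold b, two_coefs.
  destruct (Nat.eq_dec k 0); [lia|]. destruct (Nat.eq_dec k n); [lia|].
  rewrite (ip_act I HI), !ip_zero_l. ring. }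
assert (B0 : b 0%nat = ip p r).
{ unfold b, two_coefs. simpl Nat.eq_dec. cbv iota.
  exact (f_equal (fun o => ip o r) (act_1 I HI p)). }
assert (Bn : b n = ip (act I (z ^ n) q) r).
{ unfold b, two_coefs. destruct (Nat.eq_dec n 0); [lia|]. destruct (Nat.eq_dec n n); [reflexivity|lia]. }
replace (ip (plus p (act I (z ^ n) q)) r) with (sum_n b n).
- apply is_series_finite. intros k Hk. apply Bz; lia.
- rewrite ip_plus_l, <- B0, <- Bn.
  assert (S : forall k, (k < n)%nat -> sum_n b k = b 0%nat).
  { induction k as [|k IH]; intros Hk; [apply sum_O|].
    rewrite sum_Sn, IH, (Bz (S k)) by lia. exact (Rplus_0_r _). }
  destruct n as [|n]; [lia|]. rewrite sum_Sn, S by lia. reflexivity.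
Qed.

Theorem theorem1p6 :
  forall f : Oct -> Oct,
    slice_regular unit_ball f ->
    bounded_on unit_ball f ->
    let d := diameter (image f unit_ball) in
    (forall n : nat, (0 < n)%nat ->
       norm (slice_deriv_n n f Ozero) / INR (fact n) <= 1 / 2 * d) /\
    (forall n0 : nat, (0 < n0)%nat ->
       (norm (slice_deriv_n n0 f Ozero) / INR (fact n0) = 1 / 2 * d <->
        exists (I : Oct) (theta : R), imag_unit I /\
          forall w : Oct, unit_ball w ->
            f w = plus (f Ozero)
              (scal (1 / 2) (Omult (Opow w n0) (scal d (Oexp I theta)))))).
Proof.
intros f Hreg Hbd d.
pose proof (slice_regular_series f Hreg) as Hf.
pose proof (taylor_coef_summable f Hreg) as Ha.
set (a := taylor_coef f) in *.
pose proof (diameter_image f Hbd) as Hd. fold d in Hd.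
assert (Pd : 0 <= d).
{ eapply Rle_trans; [|exact (Hd Ozero Ozero unit_ball_Ozero unit_ball_Ozero)].
  exact (norm_ge_0 (V := Oct_NM) _). }
assert (Half : forall I theta o, scal (1 / 2) (Omult o (scal d (Oexp I theta)))
  = Omult o (scal (1 / 2 * d) (Oexp I theta))).
{ intros I theta o. rewrite <- Omult_scal_r. f_equal.
  exact (scal_assoc (K := R_AbsRing) (1 / 2) d (Oexp I theta)). }
split.
{ intros n Hn. rewrite (slice_deriv_n_0 n a f Ha Hf).
  exact (coef_le_half_diameter f a d Ha Hf Hd n Hn). }
intros n Hn. split.
- intros Heq. rewrite (slice_deriv_n_0 n a f Ha Hf) in Heq.
  assert (Hexp : exists I theta, imag_unit I /\ a n = scal (1 / 2 * d) (Oexp I theta)).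
  (* For d = 0 the coefficient is zero and has no direction; any unit and angle serve. Otherwise
     [a n] is normalised to norm 1. *)
  { destruct (Req_dec d 0) as [Z|Nd].
    - exists Oi, 0. split; [exact imag_unit_Oi|]. rewrite Z, Rmult_0_r in *.
      rewrite (norm_Oct_eq0 _ Heq). symmetry. exact (scal_zero_l (K := R_AbsRing) (Oexp Oi 0)).
    - destruct (exists_Oexp (scal (/ (1 / 2 * d)) (a n))) as (I & theta & HI & E).
      + rewrite norm_Oscal, Heq, Rabs_pos_eq; [field; lra|].
        left. apply Rinv_0_lt_compat. lra.
      + exists I, theta. split; [exact HI|]. rewrite <- E.
        rewrite (scal_assoc (1 / 2 * d) (/ (1 / 2 * d)) (a n)).
        change (mult (1 / 2 * d) (/ (1 / 2 * d))) with (1 / 2 * d * / (1 / 2 * d)).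
        rewrite Rinv_r by lra. symmetry. exact (scal_one (K := R_AbsRing) (a n)). }
  destruct Hexp as (I & theta & HI & E).
  exists I, theta. split; [exact HI|]. intros w Hw. rewrite Half, <- E.
  destruct (slice_pt_surj w) as (J & x & y & HJ & _ & ->).
  pose proof (proj1 (unit_ball_slice_pt J HJ x y) Hw) as Hxy.
  rewrite (act_Opow J HJ), (oct_series_0 a f Hf).
  apply ip_ext. intros r.
  rewrite <- (is_series_unique _ _ (Hf J x y r HJ Hxy)).
  rewrite <- (is_series_unique _ _ (two_coefs_series J (a 0%nat) (a n) r (x, y) n HJ Hn)).
  (* Both sides are now sums of series, and they agree term by term because [extremal_coef] kills
     every index other than 0 and n. *)
  apply Series_ext. intros k. unfold two_coefs.
  destruct (Nat.eq_dec k 0) as [->|N0]; [reflexivity|].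
  destruct (Nat.eq_dec k n) as [->|N1]; [reflexivity|].
  rewrite (extremal_coef f a d Ha Hf Hd n k Hn ltac:(lia) N1 Heq). reflexivity.
- intros (I & theta & HI & E).
  set (q := scal (1 / 2 * d) (Oexp I theta) : Oct).
  (* The closed formula is itself an expansion of [f], and [slice_deriv_n_0] reads the n-th
     derivative off any expansion, so no comparison with [taylor_coef] arises. *)
  assert (Hs : oct_series (two_coefs (f Ozero) q n) f).
  { intros J x y r HJ Hxy.
    rewrite (E _ (proj2 (unit_ball_slice_pt J HJ x y) Hxy)), Half, (act_Opow J HJ).
    exact (two_coefs_series J (f Ozero) q r (x, y) n HJ Hn). }
  rewrite (slice_deriv_n_0 n _ f (two_coefs_summable _ _ _) Hs).
  unfold two_coefs. destruct (Nat.eq_dec n 0); [lia|]. destruct (Nat.eq_dec n n); [|lia].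
  unfold q. rewrite norm_Oscal, (norm_Oexp I theta HI), Rabs_pos_eq; lra.
Qed.
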